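(* Let $d\in\mathbb N$ and let $(G_n)_{n\in\mathbb N}$ be an $\mathrm{FO}$-convergent sequence of finite graphs with maximum degree at most $d$, with $\lim_{n\to\infty}|G_n|=\infty$. Then there exist a graphing $\mathbf G$ and a countable graph $\hat G$ such that - $\mathbf G$ is a BS-limit of the sequence $(G_n)_{n\in\mathbb N}$; - $\hat G$ is an elementary limit of the sequence $(G_n)_{n\in\mathbb N}$; - the disjoint union $\mathbf G\cup\hat G$ is an $\mathrm{FO}$-limit of the sequence $(G_n)_{n\in\mathbb N}$.
   Context: Graphs are structures over the language with one binary relation symbol interpreted as adjacency (symmetric, irreflexive). For a first-order formula $\phi(x_1,\dots,x_p)$ and a finite graph $G$, $\langle\phi,G\rangle=|\{(v_1,\dots,v_p)\in G^p: G\models\phi(v_1,\dots,v_p)\}|/|G|^p$ (for a sentence: $1$ if $G\models\phi$, $0$ otherwise). $(G_n)$ is $\mathrm{FO}$-convergent if $(\langle\phi,G_n\rangle)_n$ converges for every first-order formula $\phi$. A graphing is $\mathbf G=(V,T_1,\dots,T_k,\mu)$ where $V$ is a standard Borel space with a (probability) measure $\mu$ and $T_1,\dots,T_k$ are measure preserving Borel involutions of $V$; it is regarded as a graph on $V$ in which $x$ is adjacent to $y$ if $x\ne y$ and $T_j(x)=y$ for some $j$. For a graph $H$ and a vertex $x$, $B_r(H,x)$ is the subgraph of $H$ induced by the vertices at distance at most $r$ from $x$, rooted at $x$; for a finite rooted graph $(F,o)$, $D_r(H,(F,o))=\{x\in H: B_r(H,x)\simeq(F,o)\}$ (isomorphism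 of rooted graphs). $\mathbf G$ is a BS-limit of $(G_n)$ if for every integer $r$ and every finite rooted graph $(F,o)$, $\mu(D_r(\mathbf G,(F,o)))=\lim_{n\to\infty}|D_r(G_n,(F,o))|/|G_n|$. $\hat G$ is an elementary limit of $(G_n)$ if for every first-order sentence $\phi$, $\hat G\models\phi$ if and only if $G_n\models\phi$ for all sufficiently large $n$. The measure $\mu$ is extended to the disjoint union $\mathbf G\cup\hat G$ by giving $\hat G$ measure zero. $\mathbf G\cup\hat G$ is an $\mathrm{FO}$-limit of $(G_n)$ if for every first-order formula $\phi$ with $p$ free variables, the set $\{(v_1,\dots,v_p)\in(\mathbf G\cup\hat G)^p:\mathbf G\cup\hat G\models\phi(v_1,\dots,v_p)\}$ is measurable and its $\mu^{\otimes p}$-measure equals $\lim_{n\to\infty}\langle\phi,G_n\rangle$ (for a sentence, $p=0$, the measure is read as $1$ if $\mathbf G\cup\hat G\models\phi$ and $0$ otherwise). *)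

(* Defs.v *)
From HB Require Import structures.
From mathcomp Require Import all_boot all_order all_algebra.
From mathcomp Require Import all_classical all_reals all_analysis.
Import Order.TTheory GRing.Theory Num.Theory.
Import numFieldNormedType.Exports.

Set Implicit Arguments.
Unset Strict Implicit.
Unset Printing Implicit Defensive.

Local Open Scope classical_set_scope.
Local Open Scope ring_scope.

Record sgraph (T : Type) := SGraph {
  adj :> rel T;
  adj_sym : symmetric adj;
  adj_irr : irreflexive adj }.

(* [formula p] : the free variables are among x_0, ..., x_(p-1).  The
   quantifier [FEx] binds variable 0 of its body; variable [i.+1] of the body
   is variable [i] outside. *)
Inductive formula : nat -> Type :=
| FEq p (i j : 'I_p) : formula p
| FAdj p (i j : 'I_p) : formula p
| FNot p (f : formula p) : formula p
| FAnd p (f g : formula p) : formula p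
| FEx p (f : formula p.+1) : formula p.

Fixpoint sat (T : Type) (G : sgraph T) (p : nat) (phi : formula p) :
    p.-tuple T -> Prop :=
  match phi in formula p return p.-tuple T -> Prop with
  | FEq _ i j => fun v => tnth v i = tnth v j
  | FAdj _ i j => fun v => G (tnth v i) (tnth v j)
  | FNot _ f => fun v => ~ sat G f v
  | FAnd _ f g => fun v => sat G f v /\ sat G g v
  | FEx _ f => fun v => exists x, sat G f [tuple of x :: v]
  end.

Definition solutions (T : Type) (G : sgraph T) (p : nat) (phi : formula p) :
  set (p.-tuple T) := [set v | sat G phi v].

Definition models (T : Type) (G : sgraph T) (phi : formula 0) : Prop :=
  sat G phi [tuple].

(* For p = 0 this is 1 or 0, according to whether the sentence holds. *)
Definition stone_pairing (R : realType) (p : nat) (phi : formula p)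
    (V : finType) (G : sgraph V) : R :=
  #|[set v : p.-tuple V | `[< sat G phi v >]]%SET|%:R / #|V|%:R ^+ p.

Definition FO_convergent (R : realType) (V : nat -> finType)
    (G : forall n, sgraph (V n)) : Prop :=
  forall (p : nat) (phi : formula p),
    cvg (stone_pairing R phi (G n) @[n --> \oo]).

Definition max_degree_le (V : finType) (G : sgraph V) (d : nat) : Prop :=
  forall x : V, (#|[set y | G x y]%SET| <= d)%N.

Section balls.
Variables (T : Type) (G : sgraph T).

Definition dist_le (r : nat) (x y : T) : Prop :=
  exists s : seq T, [/\ path G x s, last x s = y & (size s <= r)%N].

Definition gball (r : nat) (x : T) : set T := [set y | dist_le r x y].

Lemma gball_center (r : nat) (x : T) : x \in gball r x.
Proof. by apply/mem_set; exists [::]. Qed.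

Definition induced_adj (A : set T) : rel (set_type A) :=
  fun u v => G (set_val u) (set_val v).

Lemma induced_sym (A : set T) : symmetric (@induced_adj A).
Proof. by move=> u v; exact: adj_sym. Qed.

Lemma induced_irr (A : set T) : irreflexive (@induced_adj A).
Proof. by move=> u; exact: adj_irr. Qed.

Definition induced (A : set T) : sgraph (set_type A) :=
  SGraph (@induced_sym A) (@induced_irr A).

End balls.

Definition rooted_iso (S T : Type) (G : sgraph S) (a : S) (H : sgraph T)
    (b : T) : Prop :=
  exists f : S -> T,
    [/\ bijective f, forall u v, H (f u) (f v) = G u v & f a = b].

Definition ball_class (T : Type) (G : sgraph T) (r : nat) (F : finType)
    (H : sgraph F) (o : F) : set T :=
  [set x | rooted_iso (induced G (gball G r x))
             (exist _ x (gball_center G r x)) H o].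

Definition standard_borel (R : realType) d (X : measurableType d) : Prop :=
  exists Y : metricType R,
    [/\ forall u : nat -> Y, cauchy (u @ \oo) -> exists y : Y, u @ \oo --> y,
        exists2 D : set Y, countable D & dense D &
        exists2 f : X -> Y, bijective f &
          forall B : set Y, <<s @open Y >> B <-> measurable (f @^-1` B)].

Record graphing (R : realType) d (X : measurableType d) := Graphing {
  graphing_borel : standard_borel R X;
  graphing_ninv : nat;
  involution : 'I_graphing_ninv -> X -> X;
  graphing_mu : probability X R;
  involution_measurable : forall j, measurable_fun setT (involution j);
  involution_involutive : forall j, involutive (involution j);
  involution_preserving : forall j (A : set X), measurable A ->
    graphing_mu (involution j @^-1` A) = graphing_mu A }.

Arguments involution {R d X} g j x.

Section graphing_graph.
Variables (R : realType) (d : measure_display) (X : measurableType d).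
Variable K : graphing R X.

Definition graphing_adj : rel X :=
  fun x y => (x != y) && [exists j, involution K j x == y].

Lemma graphing_sym : symmetric graphing_adj.
Proof.
move=> x y; rewrite /graphing_adj eq_sym; congr (_ && _).
by apply/existsP/existsP => -[j /eqP <-]; exists j;
  rewrite involution_involutive.
Qed.

Lemma graphing_irr : irreflexive graphing_adj.
Proof. by move=> x; rewrite /graphing_adj eqxx. Qed.

Definition graphing_graph : sgraph X := SGraph graphing_sym graphing_irr.

End graphing_graph.

Section disjoint_union.
Variables (S T : Type) (G : sgraph S) (H : sgraph T).

Definition union_adj : rel (S + T) := fun u v =>
  match u, v with
  | inl x, inl y => G x y
  | inr x, inr y => H x y
  | _, _ => false
  end.

Lemma union_sym : symmetric union_adj.
Proof. by move=> [x|x] [y|y] //=; exact: adj_sym. Qed.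

Lemma union_irr : irreflexive union_adj.
Proof. by move=> [x|x] /=; exact: adj_irr. Qed.

Definition disjoint_union : sgraph (S + T) := SGraph union_sym union_irr.

End disjoint_union.

(* The disjoint union of a measurable space X and of a countable set W, the
   latter with the discrete sigma-algebra. *)
Definition union_space d (X : measurableType d) (W : countType) : Type :=
  (X + W)%type.

Definition union_display : measure_display -> measure_display.
Proof. exact. Qed.

Section union_space.
Variables (d : measure_display) (X : measurableType d) (W : countType).
Local Notation U := (union_space X W).

HB.instance Definition _ := Choice.copy U (X + W)%type.
HB.instance Definition _ := isPointed.Build U (inl point).

Let union_measurable : set (set U) :=
  [set A | measurable ((inl : X -> U) @^-1` A)].

Let union_measurable0 : union_measurable set0.
Proof. by rewrite /union_measurable /= preimage_set0. Qed.

Let union_measurableC A : union_measurable A -> union_measurable (~` A).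
Proof. by rewrite /union_measurable /= preimage_setC; exact: measurableC. Qed.

Let union_measurable_bigcup (F : (set U)^nat) :
  (forall i, union_measurable (F i)) -> union_measurable (\bigcup_i F i).
Proof.
by rewrite /union_measurable /= preimage_bigcup; exact: bigcupT_measurable.
Qed.

HB.instance Definition _ := @isMeasurable.Build (union_display d) U
  union_measurable union_measurable0 union_measurableC union_measurable_bigcup.

Definition union_inl : X -> U := inl.

Lemma measurable_union_inl : measurable_fun setT union_inl.
Proof. by move=> _ A mA; rewrite setTI. Qed.

HB.instance Definition _ := isMeasurableFun.Build d (union_display d) X U
  union_inl measurable_union_inl.

End union_space.

(* The image of [mu] under the inclusion of X: the part W has measure zero. *)
Definition union_measure (R : realType) d (X : measurableType d)
    (mu : probability X R) (W : countType) : probability (union_space X W) R :=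
  distribution mu (@union_inl d X W).

Section power_measure.
Variables (R : realType) (d : measure_display) (X : measurableType d).

Definition tuple_cons (p : nat) (xv : X * p.-tuple X) : p.+1.-tuple X :=
  [tuple of xv.1 :: xv.2].

Lemma measurable_tuple_cons p : measurable_fun setT (@tuple_cons p).
Proof. exact: measurable_cons. Qed.

HB.instance Definition _ p := isMeasurableFun.Build _ _ _ _
  (@tuple_cons p) (@measurable_tuple_cons p).

(* The p-fold product measure on p-tuples; p = 0 gives the unit mass on the
   one-point space of empty tuples. *)
Fixpoint power_measure (m : probability X R) (p : nat) :
    probability (p.-tuple X) R :=
  match p return probability (p.-tuple X) R with
  | 0 => \d_[tuple]
  | p'.+1 => distribution (m \x power_measure m p')%E (@tuple_cons p')
  end.

End power_measure.

Section limits.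
Variables (R : realType) (V : nat -> finType) (G : forall n, sgraph (V n)).

Definition BS_limit d (X : measurableType d) (K : graphing R X) : Prop :=
  forall (r : nat) (F : finType) (H : sgraph F) (o : F),
    measurable (ball_class (graphing_graph K) r H o) /\
    (#|[set x : V n | `[< ball_class (G n) r H o x >]]%SET|%:R
       / #|V n|%:R)%:E @[n --> \oo]
      --> graphing_mu K (ball_class (graphing_graph K) r H o).

Definition elementary_limit (W : Type) (L : sgraph W) : Prop :=
  forall phi : formula 0,
    models L phi <-> \forall n \near \oo, models (G n) phi.

Definition FO_limit d (Y : measurableType d) (L : sgraph Y)
    (m : probability Y R) : Prop :=
  forall (p : nat) (phi : formula p),
    measurable (solutions L phi) /\
    (stone_pairing R phi (G n))%:E @[n --> \oo]
      --> power_measure m p (solutions L phi).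

End limits.

(* Main.v *)
(* Colouring the square of a graph of bounded degree presents it as the graph
   of boundedly many involutions, one for each pair of colours; the ball of
   radius [r] around [x] is then governed by the set of words of length at most
   [r] in these involutions that fix [x], called the type of [x]. All limits
   are taken along an ultrafilter [U] finer than the filter of cofinite sets:
   as the stone pairings converge, their limits along [U] are their limits, and
   the presentations need not converge by themselves.

   A vertex is coded by the labels of its images under all words, where the
   label at scale [r] separates the vertices joined by words of length at most
   [r] and takes each value with density about [1 / (r + 1)] at most. The
   limit distribution of the codes is an atomless measure preserved by the
   involutions. The graphing consists of the codes all of whose prefixes have
   positive measure, so that each of its points looks, at every scale, like a
   positive proportion of the vertices of almost all graphs.

   The countable graph is the part of the ultraproduct that is generated by
   the [k]-th vertices of each type, so it has as many vertices of each type as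
   almost all graphs. Adding the graphing only adds types that already have
   infinitely many vertices. By Hanf locality the disjoint union then
   satisfies the same sentences; moreover the truth of a formula at a tuple
   whose entries are pairwise far apart is determined by the types of the
   entries, in the same way in the union and in almost all graphs. Almost all
   tuples have this form on both sides, and the densities of the types converge.
   Finally, the balls isomorphic to a given finite rooted graph are first-order
   definable, so the BS-limit is the one-variable case. *)

From HB Require Import structures.
Require Import Defs.
From mathcomp Require Import all_boot all_order all_algebra.
From mathcomp Require Import all_classical all_reals all_analysis.
From mathcomp Require Import zify lra.

Import Order.TTheory GRing.Theory Num.Theory.
Import numFieldNormedType.Exports.

Set Implicit Arguments.
Unset Strict Implicit.
Unset Printing Implicit Defensive.

(** * Local types and the threshold form of Hanf locality *)

Section words.
Variable J : finType.

Definition words (r : nat) : seq (seq J) :=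
  flatten [seq [seq tval u | u <- enum {: k.-tuple J}] | k <- iota 0 r.+1].

Lemma mem_words r w : (w \in words r) = (size w <= r)%N.
Proof.
apply/flatten_mapP/idP => [[k]|sw].
  by rewrite mem_iota => /andP[_ kr] /mapP[u _ ->]; rewrite size_tuple.
exists (size w); first by rewrite mem_iota /= add0n ltnS.
by apply/mapP; exists (in_tuple w) => //; rewrite mem_enum.
Qed.

Section act.
Variables (T : eqType) (t : J -> T -> T).

Definition act (w : seq J) (x : T) : T := foldr t x w.

Lemma act_cat w u x : act (w ++ u) x = act w (act u x).
Proof. exact: foldr_cat. Qed.

Hypothesis tK : forall j, involutive (t j).

Lemma act_revK w : cancel (act w) (act (rev w)).
Proof.
elim: w => [|j w IH] x //=.
by rewrite rev_cons -cats1 act_cat /= tK IH.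
Qed.

Lemma actK_rev w : cancel (act (rev w)) (act w).
Proof. by move=> x; rewrite -{1}(revK w) act_revK. Qed.

Lemma act_eq_rev w x y : (act w x == y) = (act (rev w) y == x).
Proof. by apply/eqP/eqP => <-; rewrite ?act_revK ?actK_rev. Qed.

(** Moving one word to the other side leaves a single word whose length is the sum; this is why
    radii grow when tuples are extended. *)
Lemma act_eq2 w u x y : (act w x == act u y) = (act (rev u ++ w) x == y).
Proof. by rewrite act_cat [RHS]act_eq_rev revK eq_sym. Qed.

End act.

(* In a graph generated by [t], the type determines the rooted ball of radius
   about [r / 2]. *)
Definition typ (T : eqType) (t : J -> T -> T) r (x : T) : seq bool :=
  [seq act t w x == x | w <- words r].

(** A list replaces a cardinality because finite and infinite structures are compared; lists can be
    truncated, so [k] is a lower bound. *)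
Definition many (T : eqType) (t : J -> T -> T) r (a : seq bool) k : Prop :=
  exists s : seq T, [/\ uniq s, size s = k & {in s, forall x, typ t r x = a}].

Lemma map_eqP (A : eqType) (B : Type) (f g : A -> B) s :
  map f s = map g s -> {in s, f =1 g}.
Proof. by elim: s => //= a s IH [fg /IH {}IH] x /[!inE] /predU1P[->|/IH]. Qed.

Lemma typP (T T' : eqType) (t : J -> T -> T) (t' : J -> T' -> T') r x x' :
  typ t r x = typ t' r x' <->
  forall w, (size w <= r)%N -> (act t w x == x) = (act t' w x' == x').
Proof.
split=> [/map_eqP e w wr|e]; first by apply: e; rewrite mem_words.
by apply/eq_in_map => w; rewrite mem_words => /e.
Qed.

(** The back-and-forth invariant: the case [i = j] compares the types of the entries, the other
    cases their relative positions. *)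
Definition eqv (T T' : eqType) (t : J -> T -> T) (t' : J -> T' -> T') r p
    (v : p.-tuple T) (v' : p.-tuple T') : Prop :=
  forall i j w, (size w <= r)%N ->
    (act t w (tnth v i) == tnth v j) = (act t' w (tnth v' i) == tnth v' j).

(** Counts above the threshold [k] are not distinguished, so an infinite structure can match a large
    finite one. *)
Definition hmatch (T T' : eqType) (t : J -> T -> T) (t' : J -> T' -> T') r k :=
  forall r' k' a, (r' <= r)%N -> (k' <= k)%N ->
    many t r' a k' <-> many t' r' a k'.

Lemma hmatch_sym (T T' : eqType) (t : J -> T -> T) (t' : J -> T' -> T') r k :
  hmatch t t' r k -> hmatch t' t r k.
Proof. by move=> h r' k' a ? ?; symmetry; exact: h. Qed.

Lemma eqv_sym (T T' : eqType) (t : J -> T -> T) (t' : J -> T' -> T') r p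
  (v : p.-tuple T) (v' : p.-tuple T') : eqv t t' r v v' -> eqv t' t r v' v.
Proof. by move=> h i j w wr; rewrite h. Qed.

Lemma hmatch_le (T T' : eqType) (t : J -> T -> T) (t' : J -> T' -> T') r k r' k' :
  (r' <= r)%N -> (k' <= k)%N -> hmatch t t' r k -> hmatch t t' r' k'.
Proof.
by move=> rr kk h q l a qr lk; apply: h; [exact: leq_trans rr|exact: leq_trans kk].
Qed.

Lemma eqv_le (T T' : eqType) (t : J -> T -> T) (t' : J -> T' -> T') r r' p
    (v : p.-tuple T) (v' : p.-tuple T') :
  (r' <= r)%N -> eqv t t' r v v' -> eqv t t' r' v v'.
Proof. by move=> rr h i j w wr; apply: h; exact: leq_trans rr. Qed.

Lemma size_undup_map (A T T' : eqType) (f : A -> T) (g : A -> T') s :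
  {in s &, forall a b, (f a == f b) = (g a == g b)} ->
  size (undup (map f s)) = size (undup (map g s)).
Proof.
elim: s => //= a s IH h.
have -> : (f a \in map f s) = (g a \in map g s).
  apply/mapP/mapP => -[b bs /eqP e]; exists b => //; apply/eqP;
  by move: e; rewrite h ?mem_head // inE bs orbT.
have {}IH := IH (fun b c bs cs => h b c (mem_behead (s := a :: s) bs)
  (mem_behead (s := a :: s) cs)).
by case: ifP => //= _; rewrite IH.
Qed.

Lemma exists_notin (T : eqType) (s u : seq T) :
  uniq s -> (size (undup u) < size s)%N -> exists2 x, x \in s & x \notin u.
Proof.
move=> us; rewrite ltnNge => h; apply/hasP; rewrite -[has _ _]negbK -all_predC.
apply/negP => /allP sub; move/negP: h; apply; apply: uniq_leq_size => // x xs.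
by rewrite mem_undup; move: (sub x xs) => /=; rewrite negbK.
Qed.

Section extend.
Variables (T T' : eqType) (t : J -> T -> T) (t' : J -> T' -> T').
Hypotheses (tK : forall j, involutive (t j)).
Hypotheses (tK' : forall j, involutive (t' j)).

Lemma eqv_cons r p (v : p.-tuple T) (v' : p.-tuple T') x x' :
  eqv t t' r v v' -> typ t r x = typ t' r x' ->
  (forall i w, (size w <= r)%N ->
     (act t w (tnth v i) == x) = (act t' w (tnth v' i) == x')) ->
  eqv t t' r [tuple of x :: v] [tuple of x' :: v'].
Proof.
move=> vv /typP xx h i j w wr.
case: (unliftP ord0 i) => [i' ->|->]; case: (unliftP ord0 j) => [j' ->|->];
  rewrite ?tnthS ?tnth0.
- exact: vv.
- exact: h.
- by rewrite act_eq_rev // [RHS]act_eq_rev // h ?size_rev.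
- exact: xx.
Qed.

(* A vertex near [v] is transported along the words; for a vertex far from
   [v], the entries of type [a] near [v] and near [v'] are equally many, so
   that the counts provide a vertex of type [a] far from [v']. *)
Lemma eqv_extend r p (v : p.-tuple T) (v' : p.-tuple T') x :
  hmatch t t' r (p * size (words r)).+1 -> eqv t t' (3 * r) v v' ->
  exists x', eqv t t' r [tuple of x :: v] [tuple of x' :: v'].
Proof.
move=> hm vv.
have v1 : eqv t t' r v v' by apply: eqv_le vv; lia.
(* The radius [3 * r] is what [typE] needs: a test word and two words that transport an entry, each
   of length at most [r]. *)
have actE (i j : 'I_p) w u : (size w + size u <= 3 * r)%N ->
    (act t w (tnth v i) == act t u (tnth v j)) =
    (act t' w (tnth v' i) == act t' u (tnth v' j)).
  by move=> wu; rewrite !act_eq2 // vv // size_cat size_rev addnC.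
have typE (i : 'I_p) u : (size u <= r)%N ->
    typ t r (act t u (tnth v i)) = typ t' r (act t' u (tnth v' i)).
  by move=> ur; apply/typP => w wr; rewrite -!act_cat actE // size_cat; lia.
case: (boolP [exists i : 'I_p,
    has (fun w => act t w (tnth v i) == x) (words r)]).
  move=> /existsP[i /hasP[u]]; rewrite mem_words => ur /eqP <-.
  exists (act t' u (tnth v' i)); apply: eqv_cons => // [|j w wr].
    exact: typE.
  by rewrite actE // (leq_trans (leq_add wr ur)) //; lia.
move=> /existsPn far.
(* At most [p * size (words r)] points lie within [r] of the tuple; [l] lists the addresses of those
   with the type of [x]. *)
pose nb := [seq (i, w) | i <- enum 'I_p, w <- words r].
pose f a := act t a.2 (tnth v a.1); pose f' a := act t' a.2 (tnth v' a.1).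
pose ty := typ t r x.
pose l := [seq a <- nb | typ t r (f a) == ty].
have nbP a : a \in nb -> (size a.2 <= r)%N.
  by move=> /allpairsP[[i w] [_ /=]]; rewrite mem_words => wr ->.
have lnb : {subset l <= nb} by move=> a; rewrite mem_filter => /andP[].
have szl : size (undup (map f l)) = size (undup (map f' l)).
  apply: size_undup_map => a b /lnb/nbP ar /lnb/nbP br; rewrite /f /f' actE //.
  by rewrite (leq_trans (leq_add ar br)) //; lia.
have szb : (size (undup (map f l)) <= p * size (words r))%N.
  rewrite (leq_trans (size_undup _)) // size_map size_filter.
  by rewrite (leq_trans (count_size _ _)) // size_allpairs size_enum_ord.
have xl : x \notin undup (map f l).
  rewrite mem_undup; apply/mapP => -[[i w] /lnb/nbP /= wr xE].
  by move/hasPn: (far i) => /(_ w); rewrite mem_words wr xE eqxx => /(_ isT).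
(* With [x] there is one more point of this type than there are near [v], hence than near [v'], so
   one is left over far from [v']. *)
have : many t r ty (size (undup (map f l))).+1.
  exists (x :: undup (map f l)); split => //=; first by rewrite xl undup_uniq.
  move=> y /[!inE] /predU1P[->//|]; rewrite mem_undup => /mapP[a al ->].
  by move: al; rewrite mem_filter => /andP[/eqP].
rewrite hm // szl => -[s [us ss sty]].
have [|y ys yl] := @exists_notin _ s (map f' l) us; first by rewrite ss.
exists y; apply: eqv_cons => //; first by rewrite sty.
move=> i w wr; transitivity false.
  by apply/negbTE/(hasPn (far i)); rewrite mem_words.
apply/esym/negbTE; apply: contra yl => /eqP ye; apply/mapP; exists (i, w) => //.
rewrite mem_filter /f /= typE // ye sty // eqxx /=.
by apply/allpairsP; exists (i, w); rewrite mem_enum mem_words.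
Qed.

End extend.

(** Iterates [eqv_extend] from the empty tuple; each added entry triples the radius required of the
    others. *)
Lemma eqv_realize p r : exists r' k,
  forall (T T' : eqType) (t : J -> T -> T) (t' : J -> T' -> T'),
    (forall j, involutive (t j)) -> (forall j, involutive (t' j)) ->
    hmatch t t' r' k ->
    forall v : p.-tuple T, exists v' : p.-tuple T', eqv t t' r v v'.
Proof.
elim: p r => [|p IH] r.
  by exists 0, 0 => T T' t t' _ _ _ v; exists [tuple] => -[].
have [r' [k h]] := IH (3 * r).
exists (maxn r r'), (maxn (p * size (words r)).+1 k) => T T' t t' tK tK' hm v.
have [] := h _ _ t t' tK tK' _ [tuple of behead v].
  by apply: hmatch_le hm; rewrite leq_maxr.
move=> v' vv'; have [|x' xv] := eqv_extend tK tK' (thead v) _ vv'.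
  by apply: hmatch_le hm; rewrite leq_maxl.
by exists [tuple of x' :: v']; rewrite [v]tuple_eta.
Qed.

(** The right-hand side is that of [graphing_adj], so a graphing is generated by its involutions by
    conversion. *)
Definition gen_by (T : eqType) (t : J -> T -> T) (G : sgraph T) :=
  forall x y, G x y = (x != y) && [exists j, t j x == y].

(** Induction on the formula: equality is read off the empty word, adjacency off words of length at
    most one, and a quantifier costs one use of [eqv_extend] in each direction. *)
Theorem hanf p (phi : formula p) : exists r k,
  forall (T T' : eqType) (t : J -> T -> T) (t' : J -> T' -> T')
    (G : sgraph T) (G' : sgraph T'),
    (forall j, involutive (t j)) -> (forall j, involutive (t' j)) ->
    gen_by t G -> gen_by t' G' -> hmatch t t' r k ->
    forall (v : p.-tuple T) (v' : p.-tuple T'), eqv t t' r v v' ->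
      sat G phi v <-> sat G' phi v'.
Proof.
elim: phi => {p} [p i j|p i j|p f [r [k IH]]|p f [r [k IHf]] g [q [l IHg]]|
    p f [r [k IH]]].
- exists 0, 0 => T T' t t' G G' _ _ _ _ _ v v' vv /=.
  by have /= e := vv i j [::] isT; split=> /eqP h; apply/eqP; rewrite ?e -?e in h *.
- exists 1, 0 => T T' t t' G G' _ _ g g' _ v v' vv /=; rewrite g g'.
  have -> // : (tnth v i != tnth v j) && [exists a, t a (tnth v i) == tnth v j] =
    ((tnth v' i != tnth v' j) && [exists a, t' a (tnth v' i) == tnth v' j]).
  have /(_ [::] isT) /= -> := vv i j; congr (_ && _).
  by apply: eq_existsb => a; have /(_ [:: a] isT) := vv i j.
- exists r, k => T T' t t' G G' tK tK' g g' hm v v' vv /=.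
  by have := IH _ _ t t' G G' tK tK' g g' hm _ _ vv; tauto.
- exists (maxn r q), (maxn k l) => T T' t t' G G' tK tK' g0 g0' hm v v' vv /=.
  have hf : hmatch t t' r k by apply: hmatch_le hm; rewrite leq_maxl.
  have hg : hmatch t t' q l by apply: hmatch_le hm; rewrite leq_maxr.
  have vf : eqv t t' r v v' by apply: eqv_le vv; rewrite leq_maxl.
  have vg : eqv t t' q v v' by apply: eqv_le vv; rewrite leq_maxr.
  have := IHf _ _ t t' G G' tK tK' g0 g0' hf _ _ vf.
  by have := IHg _ _ t t' G G' tK tK' g0 g0' hg _ _ vg; tauto.
- exists (3 * r), (maxn k (p * size (words r)).+1).
  move=> T T' t t' G G' tK tK' g g' hm v v' vv /=.
  have hm1 : hmatch t t' r (p * size (words r)).+1.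
    by apply: hmatch_le hm; lia.
  have hm2 : hmatch t t' r k by apply: hmatch_le hm; lia.
  split=> -[x sx].
    have [x' xx'] := eqv_extend tK tK' x hm1 vv.
    by exists x'; apply/(IH _ _ t t' G G' tK tK' g g' hm2 _ _ xx').
  have [x' xx'] := eqv_extend tK' tK x (hmatch_sym hm1) (eqv_sym vv).
  by exists x'; apply/(IH _ _ t t' G G' tK tK' g g' hm2 _ _ (eqv_sym xx')).
Qed.

End words.

(** * Colourings of finite graphs *)

(** Vertices are coloured one at a time; at most [D] neighbours cannot use up [D.+1] colours. *)
Lemma greedy_coloring (V : finType) (e : rel V) D :
  symmetric e -> irreflexive e -> (forall x, #|[set y | e x y]%SET| <= D)%N ->
  exists c : V -> 'I_D.+1, forall x y, e x y -> c x != c y.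
Proof.
move=> esym eirr eD.
suff h (s : seq V) : exists c : V -> 'I_D.+1,
    {in s &, forall x y, e x y -> c x != c y}.
  have [c hc] := h (enum V); exists c => x y.
  by apply: hc; rewrite mem_enum.
elim: s => [|x s [c IH]]; first by exists (fun=> ord0).
have [a ax] : exists a, a \notin [set c y | y in [set y | e x y]%SET]%SET.
  apply/existsP; rewrite -negb_forall; apply/negP => /forallP h.
  have : (#|'I_D.+1| <= #|[set c y | y in [set y | e x y]%SET]%SET|)%N.
    by apply: subset_leq_card; apply/fintype.subsetP => a _; exact: h.
  rewrite card_ord leqNgt => /negP; apply.
  by rewrite ltnS (leq_trans (leq_imset_card _ _)).
have ac y : e x y -> a != c y.
  by move=> xy; apply: contraNneq ax => ->; apply: imset_f; rewrite inE.
exists (fun y => if y == x then a else c y) => y z /=.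
rewrite !inE => /predU1P[->|ys] /predU1P[->|zs]; rewrite ?eqxx ?eirr //.
- by case: ifP => [/eqP ->|_]; rewrite ?eirr // => /ac.
- by case: ifP => [/eqP ->|_]; rewrite ?eirr // esym eq_sym => /ac.
- case: ifP => [/eqP ->|_]; case: ifP => [/eqP ->|_]; rewrite ?eirr //.
  + by move=> /ac.
  + by rewrite esym eq_sym => /ac.
  + exact: IH.
Qed.

Section involutions.
Variables (V : finType) (G : sgraph V) (d : nat).
Hypothesis Gd : max_degree_le G d.

Let N x : {set V} := (x |: [set y | G x y])%SET.

Let mem_N x y : (y \in N x) = (y == x) || G x y.
Proof. by rewrite !inE. Qed.

Let N_sym x y : (y \in N x) = (x \in N y).
Proof. by rewrite !mem_N eq_sym adj_sym. Qed.

Let card_N x : (#|N x| <= d.+1)%N.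
Proof. by rewrite /N cardsU1; have := Gd x; lia. Qed.

(** Closed neighbourhoods meet exactly at distance at most two, so this is adjacency in the square
    of [G]. *)
Let e2 x y := (x != y) && [exists z, (z \in N x) && (z \in N y)].

Let card_e2 x : (#|[set y | e2 x y]%SET| <= d.+1 * d.+1)%N.
Proof.
apply: (@leq_trans #|(\bigcup_(z in N x) N z)%SET|).
  apply: subset_leq_card; apply/fintype.subsetP => y; rewrite inE => /andP[_].
  by move=> /existsP[z /andP[zx zy]]; apply/bigcupP; exists z; rewrite // N_sym.
apply: (@leq_trans (\sum_(z in N x) #|N z|)).
  apply: (big_ind2 (fun (A : {set V}) n => #|A| <= n)%N) => [|A a B b Aa Bb|//].
    by rewrite cards0.
  by rewrite (leq_trans (leq_card_setU _ _).1) // leq_add.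
apply: (@leq_trans (\sum_(z in N x) d.+1)); first by apply: leq_sum => z _.
by rewrite sum_nat_const leq_mul2r card_N orbT.
Qed.

(* A proper colouring of the square of [G] makes the neighbours of a vertex
   distinguishable by colour; each pair of colours gives an involution that
   swaps the ends of the edges with these colours. *)
Lemma exists_involutions : exists t : 'I_#|{: 'I_(d.+1 * d.+1).+1 *
    'I_(d.+1 * d.+1).+1}| -> V -> V,
  (forall j, involutive (t j)) /\ gen_by t G.
Proof.
have [|| c cP] := @greedy_coloring V e2 _ _ _ card_e2.
- move=> x y; rewrite /e2 eq_sym; congr (_ && _).
  by apply: eq_existsb => z; rewrite andbC.
- by move=> x; rewrite /e2 eqxx.
(* The neighbour of [v] of colour [b], unique because distinct neighbours of [v] are adjacent in the
   square; the default [v] makes the involutions fix the other vertices. *)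
pose nbr b v := odflt v [pick w | G v w && (c w == b)].
have Gne x y : G x y -> x != y by case: eqP => // ->; rewrite adj_irr.
have Gc x y : G x y -> c x != c y.
  move=> xy; apply: cP; rewrite /e2 Gne //=; apply/existsP; exists x.
  by rewrite !mem_N eqxx adj_sym xy orbT.
have nbrE v w : G v w -> nbr (c w) v = w.
  rewrite /nbr => vw; case: pickP => [w' /andP[vw' cw]|/(_ w)]; last first.
    by rewrite vw eqxx.
  apply/eqP; apply: contraLR cw => ww; apply: cP; rewrite /e2 ww /=.
  by apply/existsP; exists v; rewrite !mem_N adj_sym vw' adj_sym vw !orbT.
have nbrP b v : nbr b v = v \/ G v (nbr b v) /\ c (nbr b v) = b.
  by rewrite /nbr; case: pickP => [w /andP[vw /eqP cw]|_]; [right|left].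
pose t (a : 'I_(d.+1 * d.+1).+1 * 'I_(d.+1 * d.+1).+1) v :=
  if c v == a.1 then nbr a.2 v else if c v == a.2 then nbr a.1 v else v.
have tP a v : t a v = v \/ G v (t a v).
  rewrite /t; case: ifP => _; first by case: (nbrP a.2 v) => [|[]]; auto.
  by case: ifP => _; auto; case: (nbrP a.1 v) => [|[]]; auto.
have tK a : involutive (t a).
  move=> v; case: (tP a v) => [tv|]; first by rewrite !tv.
  rewrite {1 3}/t; case: ifP => [/eqP cv|/negbT cv].
    case: (nbrP a.2 v) => [->|[vw cw] _]; first by rewrite adj_irr.
    by rewrite /t cw -cv (eq_sym a.2) -{1}cw (negbTE (Gc _ _ vw)) eqxx nbrE // adj_sym.
  case: ifP => [/eqP cv'|]; last by rewrite adj_irr.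
  case: (nbrP a.1 v) => [->|[vw cw] _]; first by rewrite adj_irr.
  by rewrite /t cw eqxx -cv' nbrE // adj_sym.
(* Pairs of colours are enumerated by an ordinal, the index type of the involutions of a
   [graphing]. *)
exists (fun j => t (enum_val j)); split => // x y.
apply/idP/andP => [xy|[xy /existsP[j /eqP ty]]].
  split; first exact: Gne.
  apply/existsP; exists (enum_rank (c x, c y)).
  by rewrite enum_rankK /t eqxx nbrE.
by move: xy; case: (tP (enum_val j) x); rewrite ty => // ->; rewrite eqxx.
Qed.

End involutions.

(** Within a residue class the quotient by [k.+1] determines the index. *)
Lemma card_modn_class (n k a : nat) :
  (#|[set i : 'I_n | i %% k.+1 == a]%SET| <= (n %/ k.+1).+1)%N.
Proof.
have lt (i : 'I_n) : (i %/ k.+1 < (n %/ k.+1).+1)%N.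
  by rewrite ltnS leq_div2r // ltnW.
rewrite -[leqRHS]card_ord.
apply: (@leq_card_in _ _ (fun i => Ordinal (lt i))) => i j /[!inE].
move=> /eqP ia /eqP ja [e]; apply: val_inj => /=.
by rewrite (divn_eq i k.+1) e ia -ja -divn_eq.
Qed.

(* Proper colouring of the [r]-th power, refined by the rank modulo [r.+1] to
   make the classes small. *)
Lemma exists_labelling (J V : finType) (t : J -> V -> V) r :
  (forall j, involutive (t j)) ->
  exists c : V -> nat, [/\
    forall v, (c v < (size (words J r)).+1 * r.+1)%N,
    forall v w, (size w <= r)%N -> act t w v != v -> c (act t w v) != c v &
    forall a, (#|[set v | c v == a]%SET| <= (#|V| %/ r.+1).+1)%N].
Proof.
move=> tK.
pose e x y := (x != y) && has (fun w => act t w x == y) (words J r).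
have [||| c cP] := @greedy_coloring V e (size (words J r)).
- move=> x y; rewrite /e eq_sym; congr (_ && _).
  by apply/hasP/hasP => -[w]; rewrite mem_words => wr h;
    exists (rev w); rewrite ?mem_words ?size_rev // -act_eq_rev.
- by move=> x; rewrite /e eqxx.
- move=> x; rewrite -(size_map (fun w => act t w x) (words J r)).
  apply: leq_trans (card_size _); apply: subset_leq_card; apply/fintype.subsetP => y.
  by rewrite inE => /andP[_ /hasP[w wr /eqP <-]]; exact: map_f.
(* The quotient of the label by [r.+1] is the colour, which separates; the remainder is that of the
   rank, which keeps the classes small. *)
exists (fun v => c v * r.+1 + enum_rank v %% r.+1)%N; split.
- by move=> v; have := ltn_ord (c v); have := ltn_pmod (enum_rank v) (ltn0Sn r); nia.
- move=> v w wr wv; apply: contraNneq (cP (act t w v) v _) => [ce|]; last first.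
    rewrite /e wv /=; apply/hasP; exists (rev w); rewrite ?mem_words ?size_rev //.
    by rewrite act_revK.
  apply/eqP/val_inj => /=; move/(congr1 (divn^~ r.+1)): ce.
  by rewrite !divnMDl // !divn_small ?ltn_pmod // !addn0.
- move=> a; apply: leq_trans (card_modn_class #|V| r (a %% r.+1)).
  rewrite -(card_imset _ (@enum_rank_inj V)); apply: subset_leq_card.
  apply/fintype.subsetP => i /imsetP[v /[!inE] /eqP <- ->].
  by rewrite modnMDl modn_mod.
Qed.

Local Open Scope classical_set_scope.
Local Open Scope ring_scope.

(** * The measure on the branches of a weighted binary tree *)

Record tree_weight (R : realType) := TreeWeight {
  tweight :> seq bool -> R;
  tweight_ge0 : forall s, 0 <= tweight s;
  tweight_nil : tweight [::] = 1;
  tweight_rcons : forall s,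
    tweight s = tweight (rcons s false) + tweight (rcons s true) }.

Section walk.
Variables (R : realType) (m : tree_weight R).

(* The interval [0, 1[ is cut according to [m]; the walk follows the nested
   intervals containing [t] and records their left ends. *)
Fixpoint walk (t : R) (k : nat) : seq bool * R :=
  if k is k'.+1 then
    let: (s, a) := walk t k' in
    if t < a + m (rcons s false) then (rcons s false, a)
    else (rcons s true, a + m (rcons s false))
  else ([::], 0).

Definition walk_bit (t : R) (k : nat) : bool := last false (walk t k.+1).1.

Lemma walk_mkseq t k : (walk t k).1 = mkseq (walk_bit t) k.
Proof.
elim: k => //= k; rewrite mkseqS /walk_bit /=.
by case: (walk t k) => s a /= ->; case: ifP => _; rewrite last_rcons.
Qed.

(** Induction along [s]: the interval of the points that follow [s] is cut in two at the next
    bit. *)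
Lemma walk_interval s : exists a, [/\ 0 <= a, a + m s <= 1 &
  forall t, 0 <= t < 1 ->
    ((walk t (size s)).1 == s) = (a <= t < a + m s) /\
    ((walk t (size s)).1 == s -> (walk t (size s)).2 = a)].
Proof.
elim/last_ind: s => [|s b [a [a0 a1 IH]]].
  exists 0; rewrite tweight_nil; split=> // t t01.
  by rewrite add0r t01.
have ms := tweight_rcons m s.
have m0 := tweight_ge0 m (rcons s false).
have m1 := tweight_ge0 m (rcons s true).
exists (if b then a + m (rcons s false) else a); split.
- by case: b; lra.
- by case: b; lra.
move=> t t01; have [e1 e2] := IH t t01.
rewrite size_rcons /=; case: (walk t (size s)) e1 e2 => s' a' /= e1 e2.
case: (eqVneq s' s) e1 e2 => [->|ss].
  move=> /esym/andP[at1 at2] /(_ isT) ->.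
  case: ltP => h; case: b => /=; rewrite ?eqxx ?eqseq_rcons ?eqxx /=; split=> //;
  by apply/esym; apply/idP; apply/idP; lra.
(* A walk that has already left [s] cannot come back, and [t] avoids both halves of the interval of
   [s]. *)
move=> /esym/negbT; rewrite negb_and -ltNge -leNgt => h _.
have ne b' : (rcons s' b' == rcons s b) = false.
  by rewrite eqseq_rcons (negbTE ss).
case: ltP => _; rewrite ne /=; split=> //; apply/esym/negP => /andP[];
  by case: b {ne} => /=; case/orP: h; lra.
Qed.

(** The point [t] lies in the half-open interval of its own prefix, which therefore has positive
    length. *)
Lemma walk_gt0 t k : 0 <= t < 1 -> 0 < m (mkseq (walk_bit t) k).
Proof.
move=> t01; have [a [_ _ /(_ t t01)[+ _]]] := walk_interval (mkseq (walk_bit t) k).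
by rewrite size_mkseq walk_mkseq eqxx => /esym/andP[]; lra.
Qed.

End walk.

Section unit_measure.
Variable R : realType.

Definition unit_interval : set (measurableTypeR R) := `[0, 1[%classic.

Lemma measurable_unit : measurable unit_interval.
Proof. exact: measurable_itv. Qed.

Definition unit_measure : set (measurableTypeR R) -> \bar R :=
  mrestr lebesgue_measure measurable_unit.

HB.instance Definition _ := Measure.on unit_measure.

Let unit_measureT : unit_measure setT = 1%E.
Proof.
by rewrite /unit_measure /mrestr setTI lebesgue_measure_itv /= lte_fin ltr01 oppr0 adde0.
Qed.

HB.instance Definition _ :=
  Measure_isProbability.Build _ _ _ unit_measure unit_measureT.

End unit_measure.

(* Keeping only the sequences whose prefixes all have positive weight loses no
   measure. *)
Definition branch (R : realType) (m : tree_weight R) :=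
  {x : nat -> bool | `[< forall k, 0 < m (mkseq x k) >]}.

Section branch.
Variables (R : realType) (m : tree_weight R).
Local Notation X := (branch m).

Definition bits (x : X) : nat -> bool := sval x.

Lemma branch_gt0 (x : X) k : 0 < m (mkseq (bits x) k).
Proof. by have /asboolP := svalP x; exact. Qed.

Lemma bits_inj : injective bits.
Proof. by move=> x y; exact: val_inj. Qed.

Lemma walk_bit_branch (t : R) : 0 <= t < 1 ->
  `[< forall k, 0 < m (mkseq (walk_bit m t) k) >].
Proof. by move=> t01; apply/asboolP => k; exact: walk_gt0. Qed.

Lemma zero_unit : 0 <= (0 : R) < 1. Proof. by rewrite lexx ltr01. Qed.

Definition walk_branch (t : R) : X :=
  match pselect (0 <= t < 1) with
  | left h => exist _ (walk_bit m t) (walk_bit_branch h)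
  | right _ => exist _ (walk_bit m 0) (walk_bit_branch zero_unit)
  end.

Lemma bits_walk t : 0 <= t < 1 -> bits (walk_branch t) = walk_bit m t.
Proof. by rewrite /walk_branch; case: pselect. Qed.

HB.instance Definition _ := gen_eqMixin X.
HB.instance Definition _ := gen_choiceMixin X.
HB.instance Definition _ := isPointed.Build X (walk_branch 0).

(** * The metric and the Borel sets of the space of branches *)

Definition branch_dist (x y : X) : R :=
  if pselect (exists n, bits x n != bits y n) is left e
  then 2^-1 ^+ (ex_minn e) else 0.

Lemma branch_dist_le x y n : (forall i, (i < n)%N -> bits x i = bits y i) ->
  branch_dist x y <= 2^-1 ^+ n.
Proof.
move=> h; rewrite /branch_dist; case: pselect => [e|_]; last by rewrite exprn_ge0.
case: ex_minnP => k xk _; rewrite ler_wiXn2l ?invr_ge0 // ?invf_le1 ?ler1n //.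
by rewrite leqNgt; apply: contra xk => /h ->.
Qed.

Lemma branch_dist_ge x y n : bits x n != bits y n ->
  2^-1 ^+ n <= branch_dist x y.
Proof.
move=> h; rewrite /branch_dist; case: pselect => [e|[]]; last by exists n.
case: ex_minnP => k xk kmin; rewrite ler_wiXn2l ?invr_ge0 // ?invf_le1 ?ler1n //.
exact: kmin.
Qed.

Lemma branch_distxx x : branch_dist x x = 0.
Proof.
by rewrite /branch_dist; case: pselect => // e; exfalso; case: e => n; rewrite eqxx.
Qed.

Lemma branch_dist_eq0 x y : branch_dist x y = 0 -> x = y.
Proof.
move=> d0; apply: bits_inj; apply/funext => n; apply: contrapT => /eqP/branch_dist_ge.
by rewrite d0 leNgt exprn_gt0.
Qed.

Lemma branch_distC x y : branch_dist x y = branch_dist y x.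
Proof.
suff le u v : branch_dist u v <= branch_dist v u.
  by apply/eqP; rewrite eq_le !le.
rewrite {1}/branch_dist; case: pselect => [e|h].
  by case: ex_minnP => k uk _; apply: branch_dist_ge; rewrite eq_sym.
by rewrite /branch_dist; case: pselect => // e; rewrite exprn_ge0.
Qed.

Lemma branch_dist_ge0 x y : 0 <= branch_dist x y.
Proof. by rewrite /branch_dist; case: pselect => // e; rewrite exprn_ge0. Qed.

(** Where [x] and [z] first differ, [y] differs from one of them. *)
Lemma branch_dist_triangle y x z :
  branch_dist x z <= branch_dist x y + branch_dist y z.
Proof.
rewrite {1}/branch_dist; case: pselect => [e|_]; last first.
  by rewrite addr_ge0 ?branch_dist_ge0.
case: ex_minnP => k xz _; case: (eqVneq (bits x k) (bits y k)) => [xy|/branch_dist_ge h].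
  rewrite xy in xz; rewrite (le_trans (branch_dist_ge xz)) // lerDr.
  exact: branch_dist_ge0.
by rewrite (le_trans h) // lerDl branch_dist_ge0.
Qed.

HB.instance Definition _ := isMetric.Build R X branch_distxx branch_dist_eq0
  branch_distC branch_dist_triangle.

Definition cyl (s : seq bool) : set X := [set x | mkseq (bits x) (size s) = s].

Lemma mkseq_eqP (x y : nat -> bool) k :
  (forall i, (i < k)%N -> x i = y i) <-> mkseq x k = mkseq y k.
Proof.
split=> [h|h i ik]; first by apply/eq_in_map => i; rewrite mem_iota => /h.
by rewrite -(nth_mkseq false x ik) h nth_mkseq.
Qed.

Lemma ball_cyl (x : X) (e : R) : 0 < e ->
  exists k, cyl (mkseq (bits x) k) `<=` ball x e.
Proof.
move=> e0; have [k ke] : exists k, (2^-1 : R) ^+ k < e.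
  have /cvgr0Pnorm_lt /(_ e e0) [k _ /(_ k)] : (2^-1 : R) ^+ n @[n --> \oo] --> 0.
    by apply: cvg_expr; rewrite ger0_norm ?invf_lt1 ?ltr1n.
  by move=> /(_ (leqnn k)) /=; rewrite ger0_norm ?exprn_ge0 //; exists k.
exists k => y; rewrite /cyl /= size_mkseq => /mkseq_eqP h.
rewrite ballEmdist /=; apply: le_lt_trans ke; apply: branch_dist_le => i ik.
by rewrite h.
Qed.

Lemma cyl_ball (x y : X) k : ball x (2^-1 ^+ k) y ->
  mkseq (bits y) k = mkseq (bits x) k.
Proof.
rewrite ballEmdist /= => xy; apply/mkseq_eqP => i ik; apply: contrapT => /eqP yx.
move: xy; rewrite ltNge => /negP; apply.
rewrite (le_trans _ (branch_dist_ge (n := i) _)) 1?eq_sym //.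
by rewrite ler_wiXn2l ?invr_ge0 // ?invf_le1 ?ler1n // ltnW.
Qed.

Lemma open_cyl s : open (cyl s).
Proof.
rewrite openE => x xs; apply/nbhs_ballP; exists (2^-1 ^+ size s).
  by rewrite /= exprn_gt0.
by move=> y /cyl_ball; rewrite /cyl /= => ->.
Qed.

Lemma cyl_open (A : set X) x : open A -> A x ->
  exists k, cyl (mkseq (bits x) k) `<=` A.
Proof.
rewrite openE => h /h /nbhs_ballP[e /= e0 eA].
by have [k ke] := ball_cyl x e0; exists k; apply: subset_trans eA.
Qed.

(** Prefixes stabilise along the sequence. The bitwise limit is again a branch, because each of its
    prefixes is a prefix of some [u j] and so has positive weight. *)
Lemma branch_complete (u : nat -> X) : cauchy (u @ \oo) ->
  exists y : X, u @ \oo --> y.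
Proof.
move=> /cauchy_ballP cu.
have near_u k : exists N, forall i j, (N <= i)%N -> (N <= j)%N ->
    mkseq (bits (u i)) k = mkseq (bits (u j)) k.
  have [|[A B] /= [[N1 _ h1] [N2 _ h2]] h] := cu (2^-1 ^+ k).
    by rewrite exprn_gt0.
  have hh i j : (maxn N1 N2 <= i)%N -> (maxn N1 N2 <= j)%N ->
      ball (u i) (2^-1 ^+ k) (u j).
    rewrite !geq_max => /andP[i1 _] /andP[_ j2].
    by apply: (h (u i, u j)); split; [exact: h1|exact: h2].
  by exists (maxn N1 N2) => i j iN jN; apply/esym/cyl_ball/hh.
have [N hN] := choice near_u.
(* Bit [k] is read at an index from which the prefixes of length [k.+1] are constant. *)
pose y k := bits (u (N k.+1)) k.
have yE k i : (N k <= i)%N -> exists2 j, (i <= j)%N & mkseq y k = mkseq (bits (u j)) k.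
  move=> ki; pose j := maxn i (\max_(l < k.+1) N l).
  have Nj l : (l <= k)%N -> (N l <= j)%N.
    move=> lk; rewrite /j leq_max; apply/orP; right.
    by have := @leq_bigmax _ (fun l : 'I_k.+1 => N l) (Ordinal (n := k.+1) lk).
  exists j; first by rewrite leq_maxl.
  apply/mkseq_eqP => l lk; rewrite /y.
  by have /mkseq_eqP := hN l.+1 _ j (leqnn _) (Nj _ lk); apply.
have yP : `[< forall k, 0 < m (mkseq y k) >].
  by apply/asboolP => k; have [j _ ->] := yE k _ (leqnn _); exact: branch_gt0.
exists (exist _ y yP); apply/cvg_ballP => e e0.
have [k ke] := ball_cyl (exist _ y yP : X) e0.
exists (N k) => // i /= ki; apply: ke; rewrite /cyl /= size_mkseq.
have [j ij ->] := yE k _ ki; apply: hN => //; exact: leq_trans ij.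
Qed.

Lemma branch_separable : exists2 D : set X, countable D & dense D.
Proof.
exists ((fun s => xget point (cyl s)) @` [set: seq bool]).
  by apply: (sub_countable (card_image_le _ _)); exact: countableP.
move=> O [x Ox] /cyl_open /(_ Ox)[k kO].
exists (xget point (cyl (mkseq (bits x) k))); split; last by eexists.
by apply: kO; apply: (@xgetPex _ point); exists x; rewrite /cyl /= size_mkseq.
Qed.

Definition branch_space := g_sigma_algebraType (@open X).

Lemma branch_standard : standard_borel R branch_space.
Proof.
exists X; split; [exact: branch_complete|exact: branch_separable|].
by exists id => //; exists id.
Qed.

Lemma measurable_cyl s : measurable (cyl s : set branch_space).
Proof. by apply: sub_sigma_algebra; exact: open_cyl. Qed.

Definition cylinders : set (set X) := [set A | A = set0 \/ exists s, A = cyl s].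

(** Two cylinders are nested or disjoint, according to whether the shorter word is a prefix of the
    longer one. *)
Lemma setI_closed_cylinders : setI_closed cylinders.
Proof.
move=> _ _ [->|[s ->]] [->|[s' ->]]; rewrite ?set0I ?setI0; try by left.
wlog ss : s s' / (size s <= size s')%N.
  by move=> h; case: (leqP (size s) (size s')) => [|/ltnW] /h //; rewrite setIC.
have tk x : cyl s' x -> mkseq (bits x) (size s) = take (size s) s'.
  rewrite /cyl /= => {1}<-; rewrite -map_take take_iota.
  by rewrite (minn_idPl ss).
case: (eqVneq (take (size s) s') s) => [ts|ts]; [right; exists s'|left].
  by apply/seteqP; split => x => [[]//|xs]; split=> //; rewrite /cyl /= (tk _ xs).
apply/seteqP; split => x //= -[xs /tk]; rewrite xs => h.
by rewrite -h eqxx in ts.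
Qed.

(** Cylinders form a countable basis, so every open set is a countable union of them. *)
Lemma measurable_branchE : @measurable _ branch_space = <<s cylinders >>.
Proof.
apply/seteqP; split.
  apply: smallest_sub => [|A oA]; first exact: smallest_sigma_algebra.
  have -> : A = \bigcup_(s : seq bool) (if `[< cyl s `<=` A >] then cyl s else set0).
    apply/seteqP; split => x.
      move=> Ax; have [k kA] := cyl_open oA Ax.
      exists (mkseq (bits x) k) => //; case: ifPn => [_|/asboolP//].
      by rewrite /cyl /= size_mkseq.
    by move=> [s _]; case: ifP => // /asboolP sA; exact: sA.
  apply: (@countable_bigcupT_measurable _ (g_sigma_algebraType cylinders)) => // s.
  apply: sub_sigma_algebra; case: ifP => _; [right|left] => //.
  by exists s.
apply: smallest_sub => [|_ [->|[s ->]]]; first exact: smallest_sigma_algebra.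
- exact: measurable0.
- exact: measurable_cyl.
Qed.

Lemma measurable_fun_branch d (Y : measurableType d) (D : set Y)
    (f : Y -> branch_space) :
  (forall s, measurable (D `&` f @^-1` (cyl s))) -> measurable_fun D f.
Proof.
move=> h; apply: (measurability _ measurable_branchE) => _ [_ [->|[s ->]] <-] //.
by rewrite preimage_set0 setI0; exact: measurable0.
Qed.

Lemma branch_measure_unique (mu nu : probability branch_space R) :
  (forall s, mu (cyl s) = nu (cyl s)) ->
  forall A, measurable A -> mu A = nu A.
Proof.
move=> h; apply: (@measure_unique _ R branch_space cylinders (fun=> setT)).
- exact: measurable_branchE.
- exact: setI_closed_cylinders.
- by right; exists [::]; apply/seteqP; split.
- by apply/seteqP; split => // x _; exists 0%N.
- by move=> _ [->|[s ->]]; [rewrite !measure0|exact: h].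
- by move=> _; apply: le_lt_trans (probability_le1 mu measurableT) _; rewrite ltry.
Qed.

Lemma walk_cyl s : exists a, @unit_interval R `&` walk_branch @^-1` (cyl s) =
  `[a, a + m s[%classic.
Proof.
have [a [a0 a1 h]] := walk_interval m s.
exists a; apply/seteqP; split => t /=; rewrite /unit_interval /= !in_itv /=.
  move=> [t01]; rewrite /cyl /= bits_walk // -walk_mkseq => /eqP.
  by have [-> _] := h t t01.
move=> /andP[t1 t2]; have t01 : 0 <= t < 1 by lra.
split=> //; rewrite /cyl /= bits_walk // -walk_mkseq; apply/eqP.
by have [-> _] := h t t01; rewrite t1.
Qed.

Let measurable_walk :
  measurable_fun setT (walk_branch : measurableTypeR R -> branch_space).
Proof.
apply: measurable_fun_branch => s; rewrite setTI.
(* Off the unit interval the map is constant, so that part of the preimage is everything or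
   nothing. *)
rewrite -(setIT (_ @^-1` _)) -(setUv (@unit_interval R)) setIUr setIC.
have [a ->] := walk_cyl s; apply: measurableU => //.
rewrite (_ : _ `&` _ =
  if `[< cyl s (walk_branch 0) >] then ~` @unit_interval R else set0).
  by case: ifP => // _; apply: measurableC; exact: measurable_unit.
have out t : (~` @unit_interval R) t -> walk_branch t = walk_branch 0.
  rewrite /unit_interval /= in_itv /= => t01; apply: bits_inj.
  by rewrite (bits_walk zero_unit) /walk_branch; case: pselect.
apply/seteqP; split => t /=.
  by move=> [ts /[dup] /out te t01]; rewrite -te; case: ifPn => [//|/asboolP].
by case: ifP => // /asboolP s0 /[dup] /out te t01; split=> //; rewrite te.
Qed.

HB.instance Definition _ := isMeasurableFun.Build _ _ _ _
  (walk_branch : measurableTypeR R -> branch_space)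
  measurable_walk.

(** The measure is the image of Lebesgue measure under the walk, as the points that follow [s] form
    an interval of length [m s]. *)
Lemma exists_branch_measure :
  {mu : probability branch_space R | forall s, mu (cyl s) = (m s)%:E}.
Proof.
exists (distribution (@unit_measure R)
  (walk_branch : measurableTypeR R -> branch_space)) => s.
rewrite /= /distribution /pushforward /unit_measure /mrestr setIC.
have [a ->] := walk_cyl s.
rewrite lebesgue_measure_itv /= lte_fin; case: ltP => [_|].
  by rewrite -EFinB addrAC subrr add0r.
rewrite gerDl => m0; congr EFin; apply/eqP.
by rewrite eq_le tweight_ge0 m0.
Qed.

Definition branch_measure := sval exists_branch_measure.

Lemma branch_measure_cyl s : branch_measure (cyl s) = (m s)%:E.
Proof. exact: (svalP exists_branch_measure). Qed.

End branch.

(** * Ultralimits of densities *)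

Section ultralimit.
Variables (R : realType) (U : set_system nat).
Hypothesis UU : UltraFilter U.

Lemma ultra_map (T : Type) (u : nat -> T) : UltraFilter (u @ U).
Proof.
split; first exact: fmap_proper_filter.
move=> H HP uH; apply/seteqP; split=> A; last exact: uH.
move=> HA; have [//|nA] := in_ultra_setVsetC (u @^-1` A) UU.
have /filter_ex[x []//] : H (A `&` ~` A) by apply: filterI => //; exact: uH.
Qed.

Definition ulim (u : nat -> R) : R := lim (u n @[n --> U]).

(** By compactness of the unit interval, the image ultrafilter converges. *)
Lemma ulim_cvg u : (forall n, 0 <= u n <= 1) -> u n @[n --> U] --> ulim u.
Proof.
move=> u01; have := @segment_compact R 0 1; rewrite compact_ultra.
move=> /(_ _ (ultra_map u))[|l [_ /= ul]]; last by apply/cvg_ex; exists l.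
suff : \forall n \near U, `[0, 1]%classic (u n) by [].
by apply: nearW => n; rewrite /= in_itv /= u01.
Qed.

(** An ultrafilter decides every property of the graphs, so negation commutes with [near]. *)
Lemma near_ultraN (P : nat -> Prop) :
  ~ (\forall n \near U, P n) <-> \forall n \near U, ~ P n.
Proof.
split=> [h|h h']; first by have [/h|] := in_ultra_setVsetC [set n | P n] UU.
have /filter_ex[n []//] : U ([set n | P n] `&` [set n | ~ P n]) by exact: filterI.
Qed.

End ultralimit.

Section density_def.
Variable R : realType.

Definition density (T : finType) (P : pred T) : R := #|P|%:R / #|T|%:R.

Lemma density_itv (T : finType) (P : pred T) : 0 <= density P <= 1.
Proof.
rewrite /density divr_ge0 //=; have [->|T0] := posnP #|T|.
  by rewrite invr0 mulr0 ler01.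
by rewrite ler_pdivrMr ?ltr0n // mul1r ler_nat max_card.
Qed.

Lemma density_predT (T : finType) : (0 < #|T|)%N -> density (predT : pred T) = 1.
Proof. by move=> T0; rewrite /density cardT -cardE divff // pnatr_eq0 -lt0n. Qed.

Lemma density_eq (T : finType) (P Q : pred T) : P =1 Q -> density P = density Q.
Proof. by move=> PQ; rewrite /density (eq_card PQ). Qed.

Lemma density_pred0 (T : finType) (P : pred T) : P =1 pred0 -> density P = 0.
Proof. by move=> P0; rewrite /density (eq_card0 P0) mul0r. Qed.

Lemma density_disjoint (T : finType) (P Q : pred T) :
  (forall x, P x -> ~~ Q x) -> density [predU P & Q] = density P + density Q.
Proof.
move=> PQ; rewrite /density -mulrDl -natrD; congr (_%:R / _); apply/eqP.
rewrite -cardUI [X in (_ + X)%N]eq_card0 ?addn0 // => x.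
by apply/negbTE/negP => /andP[/PQ/negP].
Qed.

Lemma density_le (T : finType) (P Q : pred T) :
  (forall x, P x -> Q x) -> density P <= density Q.
Proof.
move=> PQ; rewrite /density ler_wpM2r ?invr_ge0 // ler_nat.
by apply: subset_leq_card; apply/fintype.subsetP.
Qed.

End density_def.

(** Finite additivity over the level sets of the distinct values in [l]; a repeated value adds
    nothing. *)
Lemma density_mem_cvg (R : realType) (U : set_system nat) (FU : Filter U)
    (P : nat -> finType) (A : eqType) (f : forall n, P n -> A)
    d (Y : measurableType d) (m : probability Y R) (g : Y -> A) :
  (forall a, measurable [set y | g y == a] /\
    (density R (fun v : P n => f n v == a))%:E @[n --> U] --> m [set y | g y == a]) ->
  forall l : seq A, measurable [set y | g y \in l] /\
    (density R (fun v : P n => f n v \in l))%:E @[n --> U] --> m [set y | g y \in l].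
Proof.
move=> h; elim=> [|a l [ml cl]].
  rewrite (_ : [set y | _] = set0); last by apply/seteqP; split.
  rewrite measure0; split => //; under eq_fun do rewrite density_pred0 //.
  exact: cvg_cst.
have [al|al] := boolP (a \in l).
  have e x : (x \in a :: l) = (x \in l) by rewrite inE; case: eqP => // ->.
  under eq_set do rewrite e; split => //; apply: cvg_trans cl; apply: near_eq_cvg.
  by apply: nearW => n; congr EFin; apply: density_eq => v; rewrite e.
have [ma ca] := h a.
have -> : [set y | g y \in a :: l] = [set y | g y == a] `|` [set y | g y \in l].
  apply/seteqP; split => y /=; rewrite inE; first by move=> /orP.
  by move=> [->|->]; rewrite ?orbT.
split; first exact: measurableU.
rewrite measureU //; last first.
  by apply/seteqP; split => y //= -[/eqP ->]; rewrite (negbTE al).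
have fin Z : measurable Z -> m Z \is a fin_num by exact: fin_num_measure.
rewrite (_ : (fun n => _) = (fun n => (density R (fun v : P n => f n v == a))%:E +
    (density R (fun v : P n => f n v \in l))%:E)%E).
  by apply: cvgeD => //; apply: fin_num_adde_defr; exact: fin.
apply/funext => n; rewrite -EFinD -density_disjoint => [|v /eqP ->//].
by congr EFin; apply: density_eq => v; rewrite inE.
Qed.

(** * The limit distribution of codes *)

Section sampling.
Variables (R : realType) (V : nat -> finType) (U : set_system nat).
Hypothesis UU : UltraFilter U.
Hypothesis Voo : forall N, \forall n \near U, (N <= #|V n|)%N.
Variable code : forall n, V n -> nat -> bool.

Definition in_cyl s n (v : V n) := mkseq (code v) (size s) == s.

Definition sample_weight_fun (s : seq bool) : R :=
  ulim U (fun n => density R (@in_cyl s n)).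

Let weight_cvg s : density R (@in_cyl s n) @[n --> U] --> sample_weight_fun s.
Proof. by apply: ulim_cvg => n; exact: density_itv. Qed.

Let weight_ge0 s : 0 <= sample_weight_fun s.
Proof.
apply: limr_ge; first exact: (cvgP _ (weight_cvg (s := s))).
by apply: nearW => n; case/andP: (density_itv R (@in_cyl s n)).
Qed.

Let weight_nil : sample_weight_fun [::] = 1.
Proof.
apply: cvg_lim => //; apply: cvg_near_cst; near=> n.
rewrite (@density_eq _ _ _ predT); last by move=> v.
by rewrite density_predT //; near: n; exact: Voo.
Unshelve. all: by end_near. Qed.

Let weight_rcons s : sample_weight_fun s =
  sample_weight_fun (rcons s false) + sample_weight_fun (rcons s true).
Proof.
apply: cvg_lim => //.
rewrite (_ : (fun n => _) = (fun n => density R (@in_cyl (rcons s false) n) +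
    density R (@in_cyl (rcons s true) n))).
  exact: cvgD.
apply/funext => n; rewrite -density_disjoint => [|v].
  apply: density_eq => v; rewrite /= /in_mem /= /in_cyl !size_rcons !mkseqS !eqseq_rcons.
  by case: eqP => //; case: code.
by rewrite /in_cyl !size_rcons !mkseqS !eqseq_rcons; case: eqP => //; case: code.
Qed.

Definition sample_weight : tree_weight R :=
  TreeWeight weight_ge0 weight_nil weight_rcons.

Local Notation X := (branch_space sample_weight).
Local Notation mu := (branch_measure sample_weight).

Lemma density_event_cvg (Q : pred (seq bool)) k :
  measurable ([set x | Q (mkseq (bits x) k)] : set X) /\
  (density R (fun v : V n => Q (mkseq (code v) k)))%:E @[n --> U] -->
    mu [set x | Q (mkseq (bits x) k)].
Proof.
(* The event splits into the cylinders of the words of length [k] that satisfy [Q]. *)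
pose l := [seq s <- [seq tval u | u <- enum {: k.-tuple bool}] | Q s].
have lE (x : nat -> bool) : Q (mkseq x k) = (mkseq x k \in l).
  rewrite mem_filter andbC; case: (Q _); rewrite ?andbF ?andbT //.
  apply/esym/mapP; have sx : size (mkseq x k) == k by rewrite size_mkseq.
  by exists (Tuple sx); rewrite ?mem_enum.
under eq_set do rewrite lE.
rewrite (_ : (fun n => _) = (fun n =>
    (density R (fun v : V n => mkseq (code v) k \in l))%:E));
  last by apply/funext => n; congr EFin; apply: density_eq => v; exact: lE.
apply: (@density_mem_cvg R U _ V _ (fun n v => mkseq (code v) k) _ X mu
  (fun x => mkseq (bits x) k)) => s.
have [sk|sk] := eqVneq (size s) k.
  have -> : [set x : X | mkseq (bits x) k == s] = cyl s.
    by apply/seteqP; split => x; rewrite /cyl /= sk => /eqP.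
  split; first exact: measurable_cyl.
  rewrite branch_measure_cyl; apply/cvg_EFin; first exact: nearW.
  by have := weight_cvg (s := s); rewrite /in_cyl sk.
have ne (x : nat -> bool) : (mkseq x k == s) = false.
  by apply: contraNF sk => /eqP <-; rewrite size_mkseq.
under eq_set do rewrite ne.
rewrite (_ : [set x | _] = set0); last by apply/seteqP; split.
rewrite measure0; split => //; under eq_fun do rewrite density_pred0 //.
exact: cvg_cst.
Qed.

(** The density stays above half of its positive limit while the orders of the graphs tend to
    infinity. *)
Lemma density_gt0_card (P : forall n, pred (V n)) (l : R) : 0 < l ->
  density R (P n) @[n --> U] --> l ->
  forall N, \forall n \near U, (N <= #|P n|)%N.
Proof.
move=> l0 Pl N.
have h : \forall n \near U, l / 2 < density R (P n).
  by apply: (cvgr_gt _ Pl); lra.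
have := Voo (Num.trunc (N%:R / (l / 2))).+1; apply: filterS2 h => n h VN.
rewrite -(ler_nat R); rewrite -(ler_nat R) in VN.
have V0 : 0 < #|V n|%:R :> R by apply: lt_le_trans VN; rewrite ltr0n.
have : N%:R / (l / 2) <= #|V n|%:R.
  by apply: le_trans VN; apply/ltW; rewrite truncnS_gt.
rewrite ler_pdivrMr; last by lra.
move=> /le_trans; apply; move: h; rewrite /density ltr_pdivlMr // mulrC => /ltW //.
Qed.

Lemma branch_approx (x : X) k N :
  \forall n \near U,
    (N <= #|[pred v : V n | mkseq (code v) k == mkseq (bits x) k]|)%N.
Proof.
have := @density_gt0_card (@in_cyl (mkseq (bits x) k)) _ (branch_gt0 x k)
  (weight_cvg (s := _)) N.
apply: filterS => n /leq_trans; apply; apply/eq_leq/eq_card => v.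
by rewrite inE /in_mem /= /in_cyl size_mkseq.
Qed.

End sampling.

(** * The limit graphing *)

(** By compactness this is continuity from bit sequences to the discrete [A]; Boolean functions of
    this kind are the events whose densities converge. *)
Definition fin_dep (A : Type) (F : (nat -> bool) -> A) : Prop :=
  exists k, forall c c', mkseq c k = mkseq c' k -> F c = F c'.

Lemma mkseq_le (c c' : nat -> bool) k l : (k <= l)%N ->
  mkseq c l = mkseq c' l -> mkseq c k = mkseq c' k.
Proof.
move=> kl /mkseq_eqP h; apply/mkseq_eqP => i ik.
by apply: h; exact: leq_trans kl.
Qed.

Lemma fin_dep_coord i : fin_dep (fun c => c i).
Proof. by exists i.+1 => c c' /mkseq_eqP/(_ i (ltnSn i)). Qed.

Lemma fin_dep_cst (A : Type) (a : A) : fin_dep (fun=> a).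
Proof. by exists 0%N. Qed.

Lemma fin_dep2 (A B C : Type) (h : A -> B -> C) F G :
  fin_dep F -> fin_dep G -> fin_dep (fun c => h (F c) (G c)).
Proof.
move=> [k Fk] [l Gl]; exists (maxn k l) => c c' cc.
by rewrite (Fk c c') ?(Gl c c') //; apply: mkseq_le cc; rewrite ?leq_maxl ?leq_maxr.
Qed.

Lemma fin_dep_map (I A : Type) (F : I -> (nat -> bool) -> A) s :
  (forall i, fin_dep (F i)) -> fin_dep (fun c => [seq F i c | i <- s]).
Proof.
move=> h; elim: s => [|i s IH] /=; first exact: fin_dep_cst.
exact: (fin_dep2 cons).
Qed.

Lemma fin_dep1 (A B : Type) (h : A -> B) F :
  fin_dep F -> fin_dep (fun c => h (F c)).
Proof. by move=> [k Fk]; exists k => c c' /Fk ->. Qed.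

Section shift.
Variable J : finType.
Local Notation index := (seq J * (nat * nat))%type.

(** Applying [w] after [j] is applying [rcons w j], so this reindexing turns the code of a vertex
    into the code of its image under [j]. *)
Definition bit_shift (j : J) (c : nat -> bool) : nat -> bool := fun k =>
  if (unpickle k : option index) is Some (w, p)
  then c (pickle (rcons w j, p)) else false.

Lemma fin_dep_shift A j (F : (nat -> bool) -> A) :
  fin_dep F -> fin_dep (fun c => F (bit_shift j c)).
Proof.
move=> [k Fk].
have [l hl] : fin_dep (fun c => mkseq (bit_shift j c) k).
  apply: fin_dep_map => i; rewrite /bit_shift.
  case: (unpickle i) => [[w p]|]; [exact: fin_dep_coord|exact: fin_dep_cst].
by exists l => c c' /hl; exact: Fk.
Qed.

Definition bit_shifts (w : seq J) (c : nat -> bool) := foldr bit_shift c w.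

Lemma fin_dep_shifts A w (F : (nat -> bool) -> A) :
  fin_dep F -> fin_dep (fun c => F (bit_shifts w c)).
Proof.
elim: w F => [|j w IH] F //= h.
exact: (IH (fun c => F (bit_shift j c)) (fin_dep_shift j h)).
Qed.

End shift.

(** The sets [C i] separate points, which makes equality measurable. The classes of [lam r] are
    finitely many and small, which makes coincidences between distinct coordinates null. *)
Definition has_limit_space (R : realType) (V : nat -> finType)
    (U : set_system nat) (J : finType) (t : forall n, J -> V n -> V n) : Prop :=
  exists (dX : measure_display) (X : measurableType dX) (mu : probability X R)
    (T : J -> X -> X),
  [/\ standard_borel R X, forall j, involutive (T j),
      forall j, measurable_fun setT (T j) &
      forall j (A : set X), measurable A -> mu (T j @^-1` A) = mu A] /\
  [/\ forall r a, measurable ([set x | typ T r x == a] : set X) /\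
        (density R (fun v : V n => typ (@t n) r v == a))%:E @[n --> U] -->
          mu [set x | typ T r x == a],
      forall x r k, \forall n \near U, many (@t n) r (typ T r x) k,
      exists2 C : nat -> set X, forall i, measurable (C i) &
        forall x y, (forall i, C i x <-> C i y) -> x = y &
      exists (lam : nat -> X -> nat) (b : nat -> nat),
        [/\ forall r x, (lam r x < b r)%N,
            forall r a, measurable [set x | lam r x == a] &
            forall r a, (mu [set x | lam r x == a] <= (r.+1%:R^-1)%:E)%E]].

Section coding.
Variables (R : realType) (V : nat -> finType) (U : set_system nat).
Hypothesis UU : UltraFilter U.
Hypothesis Voo : forall N, \forall n \near U, (N <= #|V n|)%N.
Variables (J : finType) (t : forall n, J -> V n -> V n).
Hypothesis tK : forall n j, involutive (@t n j).
Variables (lab : forall n, nat -> V n -> nat) (b : nat -> nat).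
Hypothesis lab_lt : forall n r v, (@lab n r v < b r)%N.
Hypothesis lab_sep : forall n r v w, (size w <= r)%N ->
  act (@t n) w v != v -> lab r (act (@t n) w v) != lab r v.
Hypothesis lab_card : forall n r (a : nat),
  (#|[set v : V n | lab r v == a]%SET| <= (#|V n| %/ r.+1).+1)%N.

(** Indexing by words makes the involutions act by a shift of the bits; indexing by scales lets
    finitely many bits decide whether a word fixes the vertex. *)
Definition code n (v : V n) : nat -> bool := fun k =>
  if (unpickle k : option (seq J * (nat * nat))) is Some (w, (r, a))
  then lab r (act (@t n) w v) == a else false.

Lemma code_shift n j (v : V n) : code (t j v) = bit_shift j (code v).
Proof.
apply/funext => k; rewrite /code /bit_shift; case: (unpickle k) => [[w [r a]]|//].
by rewrite pickleK -cats1 act_cat.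
Qed.

Lemma code_shifts n w (v : V n) : code (act (@t n) w v) = bit_shifts w (code v).
Proof. by elim: w => //= j w <-; rewrite code_shift. Qed.

Definition weight := sample_weight R UU Voo code.
Local Notation X := (branch_space weight).
Local Notation mu := (branch_measure weight).

Lemma event_cvg (Q : (nat -> bool) -> bool) : fin_dep Q ->
  measurable ([set x | Q (bits x)] : set X) /\
  (density R (fun v : V n => Q (code v)))%:E @[n --> U] -->
    mu [set x | Q (bits x)].
Proof.
move=> [k Qk].
(* The prefix of length [k], padded with [false], determines the value of [Q]. *)
have QE c : Q c = Q (nth false (mkseq c k)).
  by apply: Qk; apply/mkseq_eqP => i ik; rewrite nth_mkseq.
have [m1 c1] := density_event_cvg R UU Voo code (fun s => Q (nth false s)) k.
have e : [set x : X | Q (bits x)] = [set x | Q (nth false (mkseq (bits x) k))].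
  by apply/seteqP; split => x /=; rewrite -QE.
rewrite e; split => //; apply: cvg_trans c1; apply: near_eq_cvg.
by apply: nearW => n; congr EFin; apply: density_eq => v; rewrite -QE.
Qed.

Lemma code_approx (x : X) (Q : (nat -> bool) -> bool) : fin_dep Q ->
  Q (bits x) -> forall N, \forall n \near U, (N <= #|[pred v : V n | Q (code v)]|)%N.
Proof.
move=> [k Qk] Qx N.
have := branch_approx (x : branch_space (sample_weight R UU Voo code)) k N.
apply: filterS => n /leq_trans; apply; apply: subset_leq_card.
by apply/fintype.subsetP => v; rewrite !inE => /eqP /Qk ->.
Qed.

(** A violation at a branch would be shared by vertices with the same prefix. Thus identities
    between finitely many bits pass from codes to branches. *)
Lemma code_transfer (Q : (nat -> bool) -> bool) : fin_dep Q ->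
  (forall n (v : V n), Q (code v)) -> forall x : X, Q (bits x).
Proof.
move=> Qf Qc x; apply/negPn/negP => nQ.
have /(_ 1%N) := @code_approx x (fun c => ~~ Q c) (fin_dep1 negb Qf) nQ.
move=> /filter_ex[n] /card_gt0P[v].
by rewrite inE Qc.
Qed.

Lemma shift_branch (j : J) (x : X) :
  `[< forall k, 0 < weight (mkseq (bit_shift j (bits x)) k) >].
Proof.
apply/asboolP => k.
pose Q c := mkseq (bit_shift j c) k == mkseq (bit_shift j (bits x)) k.
have Qf : fin_dep Q.
  apply: (@fin_dep_shift J bool j (fun c => mkseq c k == _)).
  by exists k => c c' ->.
have [l Ql] := Qf.
(* The injection [t j] maps the vertices whose codes share a long prefix with [x] to vertices whose
   codes begin like the shifted sequence. *)
have : weight (mkseq (bits x) l) <= weight (mkseq (bit_shift j (bits x)) k).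
  apply: ler_lim; try exact: (cvgP _ (ulim_cvg UU (fun n => density_itv _ _))).
  apply: nearW => n; rewrite /density; apply: ler_wpM2r; rewrite ?invr_ge0 // ler_nat.
  rewrite -(fintype.card_image (inv_inj (@tK n j))); apply: subset_leq_card.
  apply/fintype.subsetP => v /fintype.imageP[u].
  rewrite /in_mem /= /in_cyl !size_mkseq => ux ->.
  rewrite code_shift; suff : Q (code u) by [].
  by rewrite (Ql _ (bits x)) ?/Q //; exact/eqP.
exact: lt_le_trans (branch_gt0 x l).
Qed.

Definition Tx (j : J) (x : X) : X :=
  (exist _ (bit_shift j (bits x)) (shift_branch j x) : branch weight).

Lemma bits_Tx j x : bits (Tx j x) = bit_shift j (bits x). Proof. by []. Qed.

Lemma bits_act w x : bits (act Tx w x) = bit_shifts w (bits x).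
Proof. by elim: w => //= j w <-. Qed.

Lemma TxK j : involutive (Tx j).
Proof.
move=> x; apply: bits_inj; rewrite !bits_Tx; apply/funext => k; apply/eqP.
apply: (@code_transfer (fun c => bit_shift j (bit_shift j c) k == c k)) => [|n v].
  apply: (fin_dep2 eq_op); last exact: fin_dep_coord.
  apply: (@fin_dep_shift J bool j (fun c => bit_shift j c k)).
  by apply: (@fin_dep_shift J bool j (fun c => c k)); exact: fin_dep_coord.
by rewrite -!code_shift tK.
Qed.

Definition has_lab (r a : nat) : nat := pickle (([::], (r, a)) : seq J * (nat * nat)).

Lemma code_lab n (v : V n) r a : code v (has_lab r a) = (lab r v == a).
Proof. by rewrite /code pickleK. Qed.

(* By [lab_sep], agreement of the labels at scale [size w] is enough. *)
Definition fixes (w : seq J) (c : nat -> bool) : bool :=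
  all id [seq c (has_lab (size w) a) == bit_shifts w c (has_lab (size w) a) |
     a <- iota 0 (b (size w))].

Lemma fin_dep_fixes w : fin_dep (fixes w).
Proof.
apply: (fin_dep1 (all id)); apply: fin_dep_map => a.
apply: (fin_dep2 eq_op); first exact: fin_dep_coord.
by apply: (fin_dep_shifts w (F := fun c => c _)); exact: fin_dep_coord.
Qed.

Lemma fixes_code n w (v : V n) : fixes w (code v) = (act (@t n) w v == v).
Proof.
rewrite /fixes all_map -code_shifts; apply/allP/eqP => [h|-> a _] //=.
apply/eqP; apply: contraT => /(lab_sep (leqnn _)) /negP[].
have /(_ _)/= := h (lab (size w) v); rewrite mem_iota /= add0n lab_lt => /(_ isT).
by rewrite !code_lab eqxx => /eqP/esym.
Qed.

(** Agreement of the labels forces agreement of each bit [k]: this implication involves finitely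
    many bits and holds for codes. *)
Lemma fixes_bits w (x : X) : fixes w (bits x) = (act Tx w x == x).
Proof.
apply/idP/eqP => [h|]; last first.
  by rewrite /fixes -bits_act => ->; apply/allP => _ /mapP[a _ ->].
apply: bits_inj; rewrite bits_act; apply/funext => k; apply/eqP; move: h; apply/implyP.
apply: (@code_transfer (fun c => fixes w c ==> (bit_shifts w c k == c k))) => [|n v].
  apply: (fin_dep2 implb); first exact: fin_dep_fixes.
  apply: (fin_dep2 eq_op); last exact: fin_dep_coord.
  by apply: (fin_dep_shifts w (F := fun c => c _)); exact: fin_dep_coord.
by rewrite fixes_code -code_shifts; apply/implyP => /eqP ->.
Qed.

Definition code_typ r (c : nat -> bool) := [seq fixes w c | w <- words J r].

Lemma typ_bits r (x : X) : typ Tx r x = code_typ r (bits x).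
Proof. by apply/eq_map => w; rewrite fixes_bits. Qed.

Lemma typ_code n r (v : V n) : typ (@t n) r v = code_typ r (code v).
Proof. by apply/eq_map => w; rewrite fixes_code. Qed.

Lemma typ_cvg r a :
  measurable ([set x | typ Tx r x == a] : set X) /\
  (density R (fun v : V n => typ (@t n) r v == a))%:E @[n --> U] -->
    mu [set x | typ Tx r x == a].
Proof.
have [|m c] := @event_cvg (fun c => code_typ r c == a).
  by apply: (fin_dep1 (eq_op^~ a)); apply: fin_dep_map => w; exact: fin_dep_fixes.
under eq_set do rewrite typ_bits; split=> //; apply: cvg_trans c.
apply: near_eq_cvg; apply: nearW => n; congr EFin.
by apply: density_eq => v; rewrite typ_code.
Qed.

Lemma many_branch (x : X) r k :
  \forall n \near U, many (@t n) r (typ Tx r x) k.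
Proof.
pose Q c := code_typ r c == typ Tx r x.
have Qf : fin_dep Q.
  by apply: (fin_dep1 (eq_op^~ _)); apply: fin_dep_map => w; exact: fin_dep_fixes.
have Qx : Q (bits x) by rewrite /Q typ_bits.
have := code_approx Qf Qx k; apply: filterS => n; set P := [pred v | _] => kP.
exists (take k (enum P)); split.
- by rewrite take_uniq // enum_uniq.
- by rewrite size_takel // -cardE.
- by move=> v /mem_take; rewrite mem_enum /P inE /Q -typ_code => /eqP.
Qed.

Lemma measurable_Tx j : measurable_fun setT (Tx j).
Proof.
apply: measurable_fun_branch => s; rewrite setTI.
have [] := @event_cvg (fun c => mkseq (bit_shift j c) (size s) == s).
  apply: (@fin_dep_shift J bool j (fun c => mkseq c (size s) == _)).
  by exists (size s) => c c' ->.
by move=> m _; congr measurable: m; apply/seteqP; split => x /eqP.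
Qed.


Lemma density_inv n (j : J) (P : pred (V n)) :
  density R (fun v => P (t j v)) = density R P.
Proof.
rewrite /density -(fintype.card_image (inv_inj (@tK n j))).
congr (_%:R / _); apply: eq_card => v.
apply/fintype.imageP/idP => [[u Pu ->]//|Pv].
by exists (t j v); rewrite ?tK //= /in_mem /= tK.
Qed.

(** On a cylinder both measures are limits of densities, of a set of vertices and of its preimage
    under the bijection [t j]. *)
Lemma Tx_preserving j (A : set X) : measurable A -> mu (Tx j @^-1` A) = mu A.
Proof.
move=> mA.
pose f : {mfun X >-> X} := HB.pack (Tx j)
  (isMeasurableFun.Build _ _ _ _ (Tx j) (@measurable_Tx j)).
apply/esym; apply: (@branch_measure_unique R weight mu (distribution mu f)) => // s.
have [|_ c] := @event_cvg (fun c => mkseq (bit_shift j c) (size s) == s).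
  apply: (@fin_dep_shift J bool j (fun c => mkseq c (size s) == _)).
  by exists (size s) => c c' ->.
have [|_ c'] := @event_cvg (fun c => mkseq c (size s) == s).
  by exists (size s) => d d' ->.
have e1 : mu (cyl s) = mu [set x | mkseq (bits x) (size s) == s].
  by congr (mu _); apply/seteqP; split => x /eqP.
have e2 : distribution mu f (cyl s) =
    mu [set x | mkseq (bit_shift j (bits x)) (size s) == s].
  by congr (mu _); apply/seteqP; split => x /eqP.
apply: (etrans e1); apply: etrans (esym e2).
apply: (cvg_unique _ c'); first exact: ereal_hausdorff.
apply: cvg_trans c; apply: near_eq_cvg; apply: nearW => n; congr EFin.
rewrite -(density_inv j (fun v => mkseq (code v) (size s) == s)).
by apply: density_eq => v; rewrite code_shift.
Qed.

Lemma lab_class_measure r a :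
  measurable ([set x | bits x (has_lab r a)] : set X) /\
  (mu [set x | bits x (has_lab r a)] <= (r.+1%:R^-1)%:E)%E.
Proof.
have [|m c] := @event_cvg (fun c => c (has_lab r a)); first exact: fin_dep_coord.
(* The rounding term [1] in the size of a label class is absorbed by [e * #|V n|]. *)
split=> //; apply/lee_addgt0Pr => e e0.
apply: (cvge_le _ c); near=> n.
rewrite -EFinD lee_fin /density.
have V0 : (0 < #|V n|)%N by near: n; exact: Voo.
rewrite ler_pdivrMr ?ltr0n // mulrDl.
have Ve : e^-1 <= #|V n|%:R.
  apply: (@le_trans _ _ (Num.trunc e^-1).+1%:R); first exact/ltW/truncnS_gt.
  by rewrite ler_nat; near: n; exact: Voo.
have h : (#|V n| %/ r.+1)%:R <= r.+1%:R^-1 * #|V n|%:R :> R.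
  by rewrite mulrC ler_pdivlMr ?ltr0n // -natrM ler_nat leq_trunc_div.
have h2 : 1 <= e * #|V n|%:R by rewrite mulrC -ler_pdivrMr // mul1r.
apply: (@le_trans _ _ ((#|V n| %/ r.+1).+1)%:R).
  rewrite ler_nat; apply: leq_trans (lab_card n r a).
  by rewrite cardsE; apply/eq_leq/eq_card => v; rewrite /in_mem /= code_lab.
by rewrite -natr1 lerD.
Unshelve. all: by end_near. Qed.

Lemma lab_class_cover r (x : X) : exists2 a, (a < b r)%N & bits x (has_lab r a).
Proof.
have := @code_transfer (fun c => has id [seq c (has_lab r a) | a <- iota 0 (b r)]).
move=> /(_ _ _ x)/hasP[||_ /mapP[a ab ->] ha].
- apply: (fin_dep1 (has id)); apply: fin_dep_map => a; exact: fin_dep_coord.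
- move=> n v; apply/hasP; exists true => //; apply/mapP; exists (lab r v).
    by rewrite mem_iota /= add0n.
  by rewrite code_lab eqxx.
- by exists a => //; rewrite mem_iota /= add0n in ab.
Qed.

(** Every branch carries some label below [b r]; taking the least one turns the label bits into a
    partition. *)
Definition first_lab r (c : nat -> bool) :=
  find id [seq c (has_lab r a) | a <- iota 0 (b r)].

Lemma fin_dep_first_lab r : fin_dep (first_lab r).
Proof.
by apply: (fin_dep1 (find id)); apply: fin_dep_map => a; exact: fin_dep_coord.
Qed.

Lemma first_lab_lt r (x : X) : (first_lab r (bits x) < b r)%N.
Proof.
rewrite /first_lab -[ltnRHS](size_iota 0).
rewrite -[ltnRHS](size_map (fun a => bits x (has_lab r a))).
rewrite -has_find; have [a ab ha] := lab_class_cover r x.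
by apply/hasP; exists true => //; apply/mapP; exists a; rewrite ?mem_iota.
Qed.

Lemma first_lab_measure r a :
  measurable ([set x | first_lab r (bits x) == a] : set X) /\
  (mu [set x | first_lab r (bits x) == a] <= (r.+1%:R^-1)%:E)%E.
Proof.
have [m1 _] := @event_cvg (fun c => first_lab r c == a)
  (fin_dep1 (eq_op^~ a) (fin_dep_first_lab r)).
have [m2 le] := lab_class_measure r a; split=> //; apply: le_trans le.
apply: le_measure; rewrite ?inE // => x /= /eqP xa.
have ab : (a < b r)%N by rewrite -xa first_lab_lt.
have : nth false [seq bits x (has_lab r a) | a <- iota 0 (b r)] a.
  by rewrite -xa (@nth_find _ false id) // has_find size_map size_iota first_lab_lt.
by rewrite (nth_map 0%N) ?size_iota // nth_iota.
Qed.

Lemma limit_space_of_labelling : has_limit_space R U t.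
Proof.
exists _, X, mu, Tx; split; split.
- exact: branch_standard.
- exact: TxK.
- exact: measurable_Tx.
- exact: Tx_preserving.
- exact: typ_cvg.
- exact: many_branch.
- exists (fun i => [set x : X | bits x i]) => [i|x y h].
    exact: (@event_cvg (fun c => c i) (fin_dep_coord i)).1.
  apply: bits_inj; apply/funext => i; have [h1 h2] := h i.
  by apply/idP/idP.
- exists (fun r x => first_lab r (bits x)), b; split=> [r x|r a|r a].
  + exact: first_lab_lt.
  + exact: (first_lab_measure r a).1.
  + exact: (first_lab_measure r a).2.
Qed.

End coding.

Theorem exists_limit_space (R : realType) (V : nat -> finType)
    (U : set_system nat) (UU : UltraFilter U)
    (Voo : forall N, \forall n \near U, (N <= #|V n|)%N)
    (J : finType) (t : forall n, J -> V n -> V n)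
    (tK : forall n j, involutive (@t n j)) :
  has_limit_space R U t.
Proof.
have labP n r := svalP (cid (exists_labelling r (@tK n))).
apply: (@limit_space_of_labelling R V U UU Voo J t tK
  (fun n r => sval (cid (exists_labelling r (@tK n))))
  (fun r => ((size (words J r)).+1 * r.+1)%N)).
- by move=> n r v; have [h _ _] := labP n r; exact: h.
- by move=> n r v w wr wv; have [_ h _] := labP n r; exact: h.
- by move=> n r a; have [_ _ h] := labP n r; exact: h.
Qed.

(** * The countable limit *)

Lemma near_seq (T : Type) (U : set_system T) (FU : Filter U) (I : eqType)
    (s : seq I) (P : I -> T -> Prop) :
  {in s, forall i, \forall n \near U, P i n} ->
  \forall n \near U, {in s, forall i, P i n}.
Proof.
elim: s => [_|i s IH h]; first exact: nearW.
have h1 := h i (mem_head _ _).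
have h2 := IH (fun j js => h j (mem_behead (s := i :: s) js)).
apply: filterS2 h1 h2 => n Pi Ps j.
by rewrite inE => /predU1P[->|/Ps].
Qed.

Section names.
Variables (V : nat -> finType) (U : set_system nat).
Hypothesis UU : UltraFilter U.
Let FU : Filter U. Proof. exact: filter_filter. Qed.
Variables (J : finType) (t : forall n, J -> V n -> V n).
Hypothesis tK : forall n j, involutive (@t n j).

(* The name [(r, a, k, w)] denotes in each graph the image under [w] of the
   [k]-th vertex of type [a] and radius [r]. *)
Definition name := (nat * seq bool * nat * seq J)%type.

Definition name_val n (x : name) : option (V n) :=
  let: (r, a, k, w) := x in
  omap (act (@t n) w) (onth [seq v <- enum (V n) | typ (@t n) r v == a] k).

Local Notation "x =_U y" := (\forall n \near U, name_val n x = name_val n y)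
  (at level 70).

(** Among the names that agree along [U], the one with the least [pickle] is kept, so that equality
    along [U] becomes equality of names. *)
Definition named (x : name) : Prop :=
  (\forall n \near U, name_val n x) /\
  forall y, (pickle y < pickle x)%N -> ~ (x =_U y).

Definition named_type := {x : name | `[< named x >]}.
HB.instance Definition _ := Countable.on named_type.
Local Notation W := named_type.

Lemma named_val (w : W) : \forall n \near U, name_val n (val w).
Proof. by have /asboolP[] := valP w. Qed.

Lemma named_inj (w w' : W) : val w =_U val w' -> w = w'.
Proof.
move=> ww; apply: val_inj; apply/(pcan_inj pickleK)/eqP.
have /asboolP[_ wmin] := valP w; have /asboolP[_ wmin'] := valP w'.
case: ltngtP => // h; first by case: (wmin' _ h); apply: filterS ww => n ->.
by case: (wmin _ h).
Qed.

Lemma exists_rep (x : name) : (\forall n \near U, name_val n x) ->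
  exists w : W, val w =_U x.
Proof.
move=> dx; pose P m := `[< exists2 y : name, pickle y = m & y =_U x >].
have exP : exists m, P m by exists (pickle x); apply/asboolP; exists x => //; exact: nearW.
case: (ex_minnP exP) => m /asboolP[y ym yx] mmin.
have yP : `[< named y >].
  apply/asboolP; split; first by apply: filterS2 dx yx => n dx ->.
  move=> z; rewrite ym => zm yz; suff : P (pickle z) by move/mmin; rewrite leqNgt zm.
  by apply/asboolP; exists z => //; apply: filterS2 yx yz => n <- ->.
by exists (exist _ y yP).
Qed.

Lemma exists_move j (w : W) : exists w' : W,
  \forall n \near U, name_val n (val w') = omap (@t n j) (name_val n (val w)).
Proof.
case Ew : (val w) => [[[r a] k] u].
have [|w' ww'] := @exists_rep (r, a, k, j :: u).
  have := named_val w; rewrite Ew; apply: filterS => n /=.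
  by case: onth.
by exists w'; apply: filterS ww' => n -> /=; case: onth.
Qed.

Definition name_move j (w : W) : W := sval (cid (exists_move j w)).

Lemma name_moveE j w : \forall n \near U,
  name_val n (val (name_move j w)) = omap (@t n j) (name_val n (val w)).
Proof. exact: (svalP (cid (exists_move j w))). Qed.

Lemma name_moveK j : involutive (name_move j).
Proof.
move=> w; apply: named_inj; have h := name_moveE j w.
apply: filterS2 h (name_moveE j (name_move j w)) => n -> ->.
by case: name_val => //= v; rewrite tK.
Qed.

Lemma act_name_move u w : \forall n \near U,
  name_val n (val (act name_move u w)) = omap (act (@t n) u) (name_val n (val w)).
Proof.
elim: u => [|j u IH] /=; first by apply: nearW => n; case: name_val.
apply: filterS2 IH (name_moveE j (act name_move u w)) => n + ->.
by move=> ->; case: name_val.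
Qed.

(** Each of finitely many words fixes [w] or moves it, and the ultrafilter makes almost all graphs
    agree with this. *)
Lemma typ_name_move r w : \forall n \near U, forall v,
  name_val n (val w) = Some v -> typ (@t n) r v = typ name_move r w.
Proof.
have h : {in words J r, forall u, \forall n \near U, forall v,
    name_val n (val w) = Some v -> (act (@t n) u v == v) = (act name_move u w == w)}.
  move=> u _; have hu := act_name_move u w.
  case: (eqVneq (act name_move u w) w) => [uw|uw].
    apply: filterS hu => n; rewrite uw => e v vE.
    by rewrite vE /= in e; case: e => <-; rewrite eqxx.
  have /(near_ultraN UU) : ~ (val (act name_move u w) =_U val w).
    by move=> /named_inj e; rewrite e eqxx in uw.
  apply: filterS2 hu => n -> ne v vE; apply/eqP => uv; apply: ne.
  by rewrite vE /= uv.
have := near_seq FU h; apply: filterS => n hn v vE.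
by apply/typP => u ur; apply: hn vE; rewrite mem_words.
Qed.

Lemma many_name_move r a k :
  many name_move r a k <-> \forall n \near U, many (@t n) r a k.
Proof.
split=> [[s [us ss st]]|h].
  (* From names to graphs: almost everywhere the finitely many names have values of type [a], and
     distinct names have distinct values. *)
  have h1 : {in s, forall w, \forall n \near U, exists2 v,
      name_val n (val w) = Some v & typ (@t n) r v = a}.
    move=> w ws; apply: filterS2 (named_val w) (typ_name_move r w) => n.
    by case: name_val => // v _ /(_ v erefl) h; exists v; rewrite // h st.
  have h2 : {in s, forall w, \forall n \near U, {in s, forall w',
      name_val n (val w) = name_val n (val w') -> w = w'}}.
    move=> w ws; apply: (near_seq FU) => w' ws'.
    case: (eqVneq w w') => [->|ne]; first exact: nearW.
    have /(near_ultraN UU) : ~ (val w =_U val w').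
      by move=> /named_inj e; rewrite e eqxx in ne.
    by apply: filterS.
  apply: filterS2 (near_seq FU h1) (near_seq FU h2) => n hn1 hn2.
  have e : map (fun w : W => name_val n (val w)) s =
      map Some (pmap (fun w : W => name_val n (val w)) s).
    elim: s hn1 {us ss st h1 h2 hn2} => //= w s IH hn1.
    have [v -> _] := hn1 w (mem_head _ _); rewrite /= IH // => w' ws.
    by apply: hn1; rewrite inE ws orbT.
  exists (pmap (fun w : W => name_val n (val w)) s); split.
  - rewrite -(map_inj_uniq (@Some_inj _)) -e map_inj_in_uniq // => w w' ws ws'.
    exact: hn2.
  - by rewrite -ss -(size_map Some) -e size_map.
  - move=> v; rewrite mem_pmap => /mapP[w ws].
    by have [v' -> tv'] := hn1 w ws; case=> ->.
(* Conversely, the names of the first [k] vertices of type [a] are defined almost everywhere, and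
   the position among such vertices tells them apart. *)
pose x i : name := (r, a, i, [::]).
have onthE n i : (i < k)%N -> many (@t n) r a k ->
    exists v, [/\ name_val n (x i) = Some v, typ (@t n) r v = a &
      index v [seq v <- enum (V n) | typ (@t n) r v == a] = i].
  move=> ik [s [us ss st]]; set l := [seq v <- _ | _].
  have il : (i < size l)%N.
    apply: leq_trans ik _; rewrite -ss; apply: uniq_leq_size => // v vs.
    by rewrite mem_filter mem_enum st // eqxx.
  have [v0 _] : exists v0, v0 \in l.
    by case: (l) il => // v0 l' _; exists v0; rewrite mem_head.
  exists (nth v0 l i); split.
  - rewrite /name_val /x -/l; have := onthTE l i; rewrite il.
    by case E: (onth l i) => [y|] // _; rewrite (onth_nth v0 _ _ _ E).
  - by have := mem_nth v0 il; rewrite mem_filter => /andP[/eqP].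
  - by rewrite index_uniq // filter_uniq // enum_uniq.
have dx i : (i < k)%N -> exists w : W, val w =_U x i.
  move=> ik; apply: exists_rep; apply: filterS h => n /(onthE n i ik)[v [-> _ _]] //.
have [k0|/dx[w0 _]] := posnP k; first by exists [::]; rewrite k0.
have /choice[f fP] : forall i, exists w : W, (i < k)%N -> val w =_U x i.
  move=> i; case: (ltnP i k) => [/dx[w wx]|_]; first by exists w.
  by exists w0.
exists [seq f i | i <- iota 0 k]; split.
- rewrite map_inj_in_uniq ?iota_uniq // => i j; rewrite !mem_iota /= !add0n => ik jk fij.
  have /filter_ex[n [[e1 e2] hn]] : U ([set n | name_val n (val (f i)) = name_val n (x i)]
     `&` [set n | name_val n (val (f j)) = name_val n (x j)]
     `&` [set n | many (@t n) r a k]).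
    by apply: filterI => //; apply: filterI; exact: fP.
  have [v [vx _ <-]] := onthE n i ik hn; have [v' [vx' _ <-]] := onthE n j jk hn.
  have : Some v = Some v' by rewrite -vx -vx' -[LHS]e1 -[RHS]e2 fij.
  by case=> ->.
- by rewrite size_map size_iota.
- move=> w /mapP[i]; rewrite mem_iota /= add0n => ik ->.
  have /filter_ex[n [[e1 hn] ht]] : U ([set n | name_val n (val (f i)) = name_val n (x i)]
     `&` [set n | many (@t n) r a k]
     `&` [set n | forall v, name_val n (val (f i)) = Some v ->
         typ (@t n) r v = typ name_move r (f i)]).
    apply: filterI; last exact: typ_name_move.
    by apply: filterI => //; exact: fP.
  have [v [vx tv _]] := onthE n i ik hn.
  by rewrite -(ht v) // -vx; exact: e1.
Qed.

End names.

Theorem exists_countable_limit (V : nat -> finType) (U : set_system nat)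
    (UU : UltraFilter U) (J : finType) (t : forall n, J -> V n -> V n)
    (tK : forall n j, involutive (@t n j)) :
  exists (W : countType) (S : J -> W -> W), (forall j, involutive (S j)) /\
    forall r a k, many S r a k <-> \forall n \near U, many (@t n) r a k.
Proof.
exists (named_type U t), (name_move UU (t := t)).
by split; [exact: name_moveK|exact: many_name_move].
Qed.

(** * Boxes in finite powers *)

Section density_tuple.
Variable R : realType.

Lemma card_tuple_box (T : finType) p (A : 'I_p -> pred T) :
  #|[pred v : p.-tuple T | [forall i, A i (tnth v i)]]| = (\prod_(i < p) #|A i|)%N.
Proof.
rewrite -(fintype.card_image (can_inj (@finfun_of_tupleK T p))).
rewrite (_ : #|_| = #|family A|).
  by rewrite card_family foldrE big_map enumT /index_enum.
apply: eq_card => f; apply/fintype.imageP/familyP => [[v /forallP Av -> i]|Af].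
  by rewrite ffunE; exact: Av.
exists (tuple_of_finfun f); last by rewrite tuple_of_finfunK.
by apply/forallP => i; rewrite tnth_mktuple; exact: Af.
Qed.


Lemma density_box (T : finType) p (A : 'I_p -> pred T) :
  density R (fun v : p.-tuple T => [forall i, A i (tnth v i)]) =
    \prod_(i < p) density R (A i).
Proof.
rewrite /density card_tuple natrX prodf_div prodr_const card_ord.
by rewrite -natr_prod -card_tuple_box.
Qed.

Lemma density_has (T : finType) (I : eqType) (s : seq I) (P : I -> pred T) :
  density R (fun v => has (fun i => P i v) s) <= \sum_(i <- s) density R (P i).
Proof.
elim: s => [|i s IH] /=; first by rewrite big_nil density_pred0.
rewrite big_cons; apply: le_trans (lerD (lexx _) IH).
rewrite /density -mulrDl -natrD ler_wpM2r ?invr_ge0 // ler_nat.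
by rewrite -cardUI; apply: leq_trans (leq_addr _ _); apply: subset_leq_card;
  apply/fintype.subsetP => v; rewrite !inE.
Qed.

(** Summing over the value [u] of entry [i] gives [#|T|] boxes, each of density [1 / #|T| ^ 2]. *)
Lemma density_coords (T : finType) p (i j : 'I_p) (f : T -> T) : i != j ->
  density R (fun v : p.-tuple T => f (tnth v i) == tnth v j) <= #|T|%:R^-1.
Proof.
move=> ij; have [T0|T0] := posnP #|T|.
  (* As [i] exists, [p] is positive, so both denominators vanish; division by zero gives [0]. *)
  rewrite /density card_tuple T0 (_ : (0 ^ p)%N = 0%N) ?invr0 ?mulr0 //.
  by case: p i j ij => // -[].
pose A u k : pred T := if k == i then pred1 u else if k == j then pred1 (f u) else predT.
apply: (@le_trans _ _ (density R (fun v : p.-tuple T =>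
    has (fun u => [forall k, A u k (tnth v k)]) (enum T)))).
  apply: density_le => v /eqP fv; apply/hasP; exists (tnth v i); rewrite ?mem_enum //.
  apply/forallP => k; rewrite /A; case: eqP => [-> //=|_]; case: eqP => [-> /=|//].
  by rewrite fv.
apply: (le_trans (density_has _ _)).
have d1 (u : T) : density R (pred1 u) = #|T|%:R^-1.
  by rewrite /density card1 mul1r.
have box u : density R (fun v : p.-tuple T => [forall k, A u k (tnth v k)]) =
    #|T|%:R^-1 * #|T|%:R^-1.
  rewrite density_box (bigD1 i) //= (bigD1 j) 1?eq_sym //= big1 => [|k].
    by rewrite /A eqxx eq_sym (negbTE ij) eqxx !d1 mulr1.
  by move=> /andP[ki kj]; rewrite /A (negbTE ki) (negbTE kj) density_predT.
rewrite (eq_bigr _ (fun u _ => box u)) big_enum /= sumr_const -[leLHS]mulr_natl mulrA.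
by rewrite divff ?mul1r // pnatr_eq0 -lt0n.
Qed.

End density_tuple.

Section power_box.
Variables (R : realType) (d : measure_display) (Y : measurableType d).

Lemma measurable_forall d' (S : measurableType d') (I : countType) (P : I -> set S) :
  (forall i, measurable (P i)) -> measurable [set y | forall i, P i y].
Proof.
move=> mP; rewrite (_ : [set y | _] = ~` \bigcup_i ~` P i).
  apply: measurableC; apply: countable_bigcupT_measurable => [|i].
    exact: countableP.
  exact: measurableC.
apply/seteqP; split => y /= h; first by move=> [i _]; apply; exact: h.
by move=> i; apply: contrapT => Pi; apply: h; exists i.
Qed.

Lemma measurable_box p (A : 'I_p -> set Y) : (forall i, measurable (A i)) ->
  measurable [set v : p.-tuple Y | forall i, A i (tnth v i)].
Proof.
move=> mA; apply: (@measurable_forall _ _ _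
  (fun i => [set v : p.-tuple Y | A i (tnth v i)])) => i.
by have := measurable_tnth i measurableT (mA i); rewrite setTI.
Qed.

Lemma power_measure_box (m : probability Y R) p (A : 'I_p -> set Y) :
  (forall i, measurable (A i)) ->
  power_measure m p [set v : p.-tuple Y | forall i, A i (tnth v i)] =
    (\prod_(i < p) m (A i))%E.
Proof.
elim: p A => [|p IH] A mA.
  rewrite big_ord0 /= diracE mem_set //=; by case.
rewrite big_ord_recl -IH //= /distribution /pushforward.
rewrite -product_measure1E //; last first.
  apply: (@measurable_box p (fun i => A (lift ord0 i))) => i; exact: mA.
congr ((_ \x _)%E _); apply/seteqP; split => [[x v]|[x v]] /=.
  by move=> h; split=> [|i]; [have := h ord0|have := h (lift ord0 i)];
    rewrite ?tnth0 ?tnthS.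
move=> [x0 h] i; case: (unliftP ord0 i) => [k ->|->]; by rewrite ?tnth0 ?tnthS.
Qed.

Lemma power_measure_box2 (m : probability Y R) p (i j : 'I_p) (A B : set Y) :
  i != j -> measurable A -> measurable B ->
  measurable [set v : p.-tuple Y | A (tnth v i) /\ B (tnth v j)] /\
  power_measure m p [set v | A (tnth v i) /\ B (tnth v j)] = (m A * m B)%E.
Proof.
move=> ij mA mB.
pose C k := if k == i then A else if k == j then B else setT.
have mC k : measurable (C k) by rewrite /C; case: eqP => // _; case: eqP.
have -> : [set v : p.-tuple Y | A (tnth v i) /\ B (tnth v j)] =
    [set v | forall k, C k (tnth v k)].
  apply/seteqP; split => v /= => [[Av Bv] k|h].
    by rewrite /C; case: eqP => [->//|_]; case: eqP => [->|].
  by have := h i; have := h j; rewrite /C !eqxx eq_sym (negbTE ij).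
split; first exact: measurable_box.
rewrite power_measure_box // (bigD1 i) //= (bigD1 j) 1?eq_sym //= big1 => [|k].
  by rewrite /C !eqxx eq_sym (negbTE ij) mule1.
by move=> /andP[ki kj]; rewrite /C (negbTE ki) (negbTE kj) probability_setT.
Qed.

(* The coincidence [f v_i = v_j] forces [v_i] and [v_j] into linked classes of
   measure at most [1 / r.+1], for every [r]. *)
Lemma power_measure_coords (m : probability Y R) p (i j : 'I_p) (f : Y -> Y)
    (lam : nat -> Y -> option nat) (b : nat -> nat) :
  i != j -> measurable_fun setT f ->
  measurable [set v : p.-tuple Y | f (tnth v i) == tnth v j] ->
  (forall r c, measurable [set y | lam r y == c]) ->
  (forall r, m [set y | lam r y == None] = 0%E) ->
  (forall r c y, lam r y = Some c -> (c < b r)%N) ->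
  (forall r c, (m [set y | lam r y == Some c] <= (r.+1%:R^-1)%:E)%E) ->
  power_measure m p [set v | f (tnth v i) == tnth v j] = 0%E.
Proof.
move=> ij mf mE mlam lam0 lam_lt mu_lam; set E := [set v | _] in mE *.
have mflam r c : measurable [set y | lam r (f y) == c].
  by have := mf measurableT _ (mlam r c); rewrite setTI.
(* Index [0] collects the label [None], of measure zero; index [c.+1] collects the label [c]. *)
pose F r k : set (p.-tuple Y) := if k is c.+1
  then [set v | [set y | lam r (f y) == Some c] (tnth v i) /\
                [set y | lam r y == Some c] (tnth v j)]
  else [set v | setT (tnth v i) /\ [set y | lam r y == None] (tnth v j)].
have mF r k : measurable (F r k).
  by case: k => [|c]; apply: (power_measure_box2 m ij _ _).1.
have EF r : E `<=` \big[setU/set0]_(k < (b r).+1) F r k.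
  move=> v /eqP fv; rewrite -bigcup_mkord.
  case lv : (lam r (tnth v j)) => [c|]; last first.
    by exists 0%N => //; rewrite /F /= lv.
  by exists c.+1; rewrite /F /= ?ltnS ?fv ?lv //; exact: lam_lt lv.
apply/eqP; rewrite eq_le measure_ge0 andbT; apply/lee_addgt0Pr => e e0; rewrite add0e.
pose r := Num.trunc e^-1.
have re : r.+1%:R^-1 <= e.
  rewrite -[leRHS]invrK lef_pV2 ?posrE ?invr_gt0 ?ltr0n //.
  by apply/ltW; exact: truncnS_gt.
apply: (@le_trans _ _ (\sum_(k < (b r).+1) power_measure m p (F r k))%E).
  by apply: content_subadditive => // k _.
rewrite big_ord_recl (power_measure_box2 m ij _ _).2 // lam0 mule0 add0e.
apply: (@le_trans _ _ (\sum_(c < b r)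
    m [set y | lam r (f y) == Some (c : nat)] * (r.+1%:R^-1)%:E)%E).
  apply: lee_sum => c _; rewrite (power_measure_box2 m ij _ _).2 //.
  exact: lee_wpmul2l.
(* The classes pulled back along [f] are disjoint, so their measures add up to at most [1] and only
   the factor [1 / (r + 1)] remains. *)
rewrite -ge0_sume_distrl; last by move=> c _; exact: measure_ge0.
rewrite -(@measure_bigsetU _ _ _ m (fun c => [set y | lam r (f y) == Some c])) //;
  last first.
  move=> c c' _ _ [y [/= /eqP -> /eqP]]; by case.
apply: (@le_trans _ _ (1 * (r.+1%:R^-1)%:E)%E); last by rewrite mul1e lee_fin.
apply: lee_wpmul2r; first by rewrite lee_fin invr_ge0.
by apply: probability_le1; apply: bigsetU_measurable.
Qed.

End power_box.

(** * Hanf locality in the limit *)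

Notation type_of J r := ((size (words J r)).-tuple bool).

Section generic.
Variable J : finType.

Definition word_pairs r p : seq (seq J * ('I_p * 'I_p)) :=
  [seq a <- [seq (w, ij) | w <- words J r, ij <- enum {: 'I_p * 'I_p}]
     | a.2.1 != a.2.2].

Lemma mem_word_pairs r p w i j :
  ((w, (i, j)) \in word_pairs r p) = (size w <= r)%N && (i != j).
Proof.
rewrite mem_filter andbC /=; congr (_ && _).
apply/allpairsP/idP => [[[u kl] /= [+ _ [-> _]]]|wr]; first by rewrite mem_words.
by exists (w, (i, j)); rewrite /= mem_words mem_enum.
Qed.

Definition joined (T : eqType) (t : J -> T -> T) p (v : p.-tuple T) a :=
  act t a.1 (tnth v a.2.1) == tnth v a.2.2.

(** The exceptional tuples: they are negligible on both sides, and outside them the types of the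
    entries decide everything. *)
Definition clustered (T : eqType) (t : J -> T -> T) r p (v : p.-tuple T) : bool :=
  has (joined t v) (word_pairs r p).

Lemma eqv_clustered (T T' : eqType) (t : J -> T -> T) (t' : J -> T' -> T') r p
    (v : p.-tuple T) (v' : p.-tuple T') : eqv t t' r v v' ->
  clustered t r v = clustered t' r v'.
Proof.
move=> vv; apply: eq_in_has => -[w [i j]]; rewrite mem_word_pairs => /andP[wr _].
by rewrite /joined /= vv.
Qed.

Lemma eqv_separated (T T' : eqType) (t : J -> T -> T) (t' : J -> T' -> T') r p
    (v : p.-tuple T) (v' : p.-tuple T') :
  ~~ clustered t r v -> ~~ clustered t' r v' ->
  (forall i, typ t r (tnth v i) = typ t' r (tnth v' i)) -> eqv t t' r v v'.
Proof.
move=> /hasPn sv /hasPn sv' vv i j w wr.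
have [->|ij] := eqVneq i j; first by move/typP: (vv j) => ->.
have wij : (w, (i, j)) \in word_pairs r p by rewrite mem_word_pairs wr.
by have /negbTE := sv _ wij; have /negbTE := sv' _ wij; rewrite /joined /= => -> ->.
Qed.

Lemma eqv_typ (T T' : eqType) (t : J -> T -> T) (t' : J -> T' -> T') r p
    (v : p.-tuple T) (v' : p.-tuple T') i : eqv t t' r v v' ->
  typ t r (tnth v i) = typ t' r (tnth v' i).
Proof. by move=> vv; apply/typP => w wr; rewrite vv. Qed.

Lemma size_typ (T : eqType) (t : J -> T -> T) r x :
  size (typ t r x) == size (words J r).
Proof. by rewrite size_map. Qed.

Definition tuple_typ (T : eqType) (t : J -> T -> T) r p (v : p.-tuple T) :
    p.-tuple (type_of J r) :=
  [tuple Tuple (size_typ t r (tnth v i)) | i < p].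

Lemma tuple_typP (T : eqType) (t : J -> T -> T) r p (v : p.-tuple T) s :
  (tuple_typ t r v == s) = [forall i, typ t r (tnth v i) == val (tnth s i)].
Proof.
apply/eqP/forallP => [<- i|h]; first by rewrite tnth_mktuple.
apply: eq_from_tnth => i; apply: val_inj; rewrite tnth_mktuple; exact/eqP/h.
Qed.

End generic.

(** * Transfer of counts and of truth along the ultrafilter *)

Section counts.
Variables (V : nat -> finType) (U : set_system nat).
Hypothesis UU : UltraFilter U.
Let FU : Filter U. Proof. exact: filter_filter. Qed.
Variables (J : finType) (t : forall n, J -> V n -> V n).
Hypothesis tK : forall n j, involutive (@t n j).
Variables (G : forall n, sgraph (V n)).
Hypothesis tG : forall n, gen_by (@t n) (G n).

Section counts_limit.
Variables (T : eqType) (s : J -> T -> T).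
Hypothesis sK : forall j, involutive (s j).
Hypothesis manyE : forall r a k,
  many s r a k <-> \forall n \near U, many (@t n) r a k.

(** Finitely many radii, thresholds and types are involved, and each equivalence holds in almost all
    graphs. *)
Lemma near_hmatch r k : \forall n \near U, hmatch s (@t n) r k.
Proof.
have h : {in iota 0 r.+1, forall r', \forall n \near U,
    {in iota 0 k.+1, forall k', {in words bool (size (words J r')), forall a,
      many s r' a k' <-> many (@t n) r' a k'}}}.
  move=> r' _; apply: (near_seq FU) => k' _; apply: (near_seq FU) => a _.
  have [m|m] := pselect (many s r' a k').
    by have /manyE := m; apply: filterS.
  have : ~ \forall n \near U, many (@t n) r' a k' by move/manyE.
  by move/(near_ultraN UU); apply: filterS.
have := near_seq FU h; apply: filterS => n hn r' k' a rr kk.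
case: (posnP k') => [->|k0]; first by split=> _; exists [::].
have hr := hn r' _ k' _ a.
(* A positive count forces [a] to have the length of a type, so the finite list of Boolean words
   covers it. *)
have wrong (T' : eqType) (s' : J -> T' -> T') : many s' r' a k' ->
    a \in words bool (size (words J r')).
  move=> [[|x l] [_ lk xa]]; first by rewrite -lk in k0.
  by rewrite mem_words -(xa x) ?mem_head // size_map.
split=> m; have /= aw := wrong _ _ m; move: m; apply hr => //;
  by rewrite mem_iota /= add0n ltnS.
Qed.

Lemma sentence_limit (L : sgraph T) : gen_by s L -> forall phi : formula 0,
  models L phi <-> \forall n \near U, models (G n) phi.
Proof.
move=> sL phi; have [r [k h]] := hanf J phi.
have e : \forall n \near U, models L phi <-> models (G n) phi.
  have := near_hmatch r k; apply: filterS => n hm.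
  by apply: (h _ _ s (@t n) L (G n) sK (@tK n) sL (@tG n) hm) => -[].
split=> m; first by apply: filterS e => n [+ _]; exact.
have /filter_ex[n [h1 h2]] : U ([set n | models L phi <-> models (G n) phi] `&`
    [set n | models (G n) phi]) by exact: filterI.
exact/h1.
Qed.

(** Separated tuples with equal types are equivalent, so by [hanf] truth depends on the types alone.
    Tuples of the finite graphs are realised in [T] and judged there. *)
Lemma separated_limit (L : sgraph T) : gen_by s L -> forall p (phi : formula p),
  exists r (S : pred (p.-tuple (type_of J r))),
    (forall v, ~~ clustered s r v -> sat L phi v <-> S (tuple_typ s r v)) /\
    \forall n \near U, forall v, ~~ clustered (@t n) r v ->
      sat (G n) phi v <-> S (tuple_typ (@t n) r v).
Proof.
move=> sL p phi; have [r [k h]] := hanf J phi.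
have [r' [k' h']] := eqv_realize J p r.
pose S a := `[< exists v, [/\ ~~ clustered s r v, tuple_typ s r v = a & sat L phi v] >].
exists r, S.
have typE (T1 T2 : eqType) (s1 : J -> T1 -> T1) (s2 : J -> T2 -> T2)
    (v1 : p.-tuple T1) (v2 : p.-tuple T2) i :
    tuple_typ s1 r v1 = tuple_typ s2 r v2 ->
    typ s1 r (tnth v1 i) = typ s2 r (tnth v2 i).
  move=> /(congr1 (fun x => val (tnth x i))).
  by rewrite !tnth_mktuple.
have refl : hmatch s s r k by [].
have SP v : ~~ clustered s r v -> sat L phi v <-> S (tuple_typ s r v).
  move=> sv; split=> [vphi|/asboolP[v' [sv' vv' v'phi]]].
    by apply/asboolP; exists v.
  apply/(h _ _ s s L L sK sK sL sL refl v v') => //.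
  by apply: eqv_separated => // i; apply: typE.
split=> //; apply: filterS2 (near_hmatch r k) (near_hmatch r' k') => n hm hm' v sv.
have [v' vv'] := h' _ _ (@t n) s (@tK n) sK (hmatch_sym hm') v.
have -> : tuple_typ (@t n) r v = tuple_typ s r v'.
  apply: eq_from_tnth => i; apply: val_inj; rewrite !tnth_mktuple /=.
  exact: eqv_typ.
have e := h _ _ (@t n) s (G n) L (@tK n) sK (@tG n) sL (hmatch_sym hm) v v' vv'.
by apply: iff_trans e _; apply: SP; rewrite -(eqv_clustered vv').
Qed.

Lemma sat_eqv (L : sgraph T) : gen_by s L -> forall p (phi : formula p),
  exists r, forall v v', eqv s s r v v' -> sat L phi v <-> sat L phi v'.
Proof.
move=> sL p phi; have [r [k h]] := hanf J phi; exists r => v v' vv.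
exact: (h _ _ s s L L).
Qed.

End counts_limit.
End counts.

(** * The disjoint union *)

Section equality.
Variables (d : measure_display) (Y : measurableType d) (I : countType).
Variable C : I -> set Y.
Hypothesis mC : forall i, measurable (C i).
Hypothesis Csep : forall x y, (forall i, C i x <-> C i y) -> x = y.

(** Equality is a countable intersection: for every [i], both values lie in [C i] or both lie
    outside. *)
Lemma measurable_eq d' (S : measurableType d') (f g : S -> Y) :
  measurable_fun setT f -> measurable_fun setT g ->
  measurable [set s | f s == g s].
Proof.
move=> mf mg.
have mpre h i : measurable_fun setT h -> measurable (h @^-1` C i : set S).
  by move=> mh; rewrite -[X in measurable X]setTI; exact: mh.
rewrite (_ : [set s | _] = [set s | forall i,
    ((f @^-1` C i `&` g @^-1` C i) `|` (~` (f @^-1` C i) `&` ~` (g @^-1` C i))) s]).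
  apply: measurable_forall => i.
  by apply: measurableU; apply: measurableI; try apply: measurableC; exact: mpre.
apply/seteqP; split => s /= h.
  by move=> i; rewrite (eqP h); case: (pselect (C i (g s))); tauto.
by apply/eqP/Csep => i; have := h i; tauto.
Qed.

End equality.

Section union.
Variables (R : realType) (J : finType).
Variables (d : measure_display) (X : measurableType d) (T : J -> X -> X).
Hypothesis TK : forall j, involutive (T j).
Hypothesis mT : forall j, measurable_fun setT (T j).
Variables (W : countType) (S : J -> W -> W).
Hypothesis SK : forall j, involutive (S j).
Variable C : nat -> set X.
Hypothesis mC : forall i, measurable (C i).
Hypothesis Csep : forall x y, (forall i, C i x <-> C i y) -> x = y.

Local Notation M := (union_space X W).

Definition union_move (j : J) (u : M) : M :=
  match u with inl x => inl (T j x) | inr w => inr (S j w) end.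

Lemma union_moveK j : involutive (union_move j).
Proof. by case=> x /=; rewrite ?TK ?SK. Qed.

Lemma act_inl w x : act union_move w (inl x) = inl (act T w x).
Proof. by elim: w => //= j w ->. Qed.

Lemma act_inr w x : act union_move w (inr x) = inr (act S w x).
Proof. by elim: w => //= j w ->. Qed.

Lemma typ_inl r x : typ union_move r (inl x) = typ T r x.
Proof. by apply/eq_map => w; rewrite act_inl. Qed.

Lemma typ_inr r x : typ union_move r (inr x) = typ S r x.
Proof. by apply/eq_map => w; rewrite act_inr. Qed.

Lemma gen_by_union (G : sgraph X) (L : sgraph W) : gen_by T G -> gen_by S L ->
  gen_by union_move (disjoint_union G L : sgraph M).
Proof.
move=> TG SL [x|x] [y|y] /=.
- exact: TG.
- by apply/esym/existsP => -[].
- by apply/esym/existsP => -[].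
- exact: SL.
Qed.

Lemma measurable_unionE (A : set M) : measurable A = measurable ((inl : X -> M) @^-1` A).
Proof. by []. Qed.

Lemma measurable_union_move j : measurable_fun setT (union_move j).
Proof.
move=> _ A mA; rewrite setTI measurable_unionE.
by have := @mT j measurableT ((inl : X -> M) @^-1` A) mA; rewrite setTI.
Qed.

Lemma measurable_act w : measurable_fun setT (act union_move w).
Proof.
elim: w => [|j w IH] /=; first exact: measurable_id.
apply: (measurableT_comp (f := union_move j)) => //; exact: measurable_union_move.
Qed.

Definition separating (i : nat + option W) : set M :=
  match i with
  | inl i => inl @` C i
  | inr None => range inl
  | inr (Some w) => [set inr w]
  end.

Lemma measurable_separating i : measurable (separating i).
Proof.
rewrite measurable_unionE; case: i => [i|[w|]] /=.
- rewrite (_ : _ @^-1` _ = C i) //; apply/seteqP; split => x /=.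
    by move=> [y Cy [<-]].
  by exists x.
- by rewrite (_ : _ @^-1` _ = set0) //; apply/seteqP; split.
- rewrite (_ : _ @^-1` _ = setT) //; apply/seteqP; split => // x _ /=.
  by exists x.
Qed.

Lemma separatingP (u v : M) :
  (forall i, separating i u <-> separating i v) -> u = v.
Proof.
move=> h; case: u v h => [x|x] [y|y] h.
- congr inl; apply: Csep => i; have := h (inl i) => /= -[h1 h2]; split => Ci.
    by have [|z Cz [<-]] := h1; first by exists x.
  by have [|z Cz [<-]] := h2; first by exists y.
- have := h (inr None) => /= -[[]//]; by exists x.
- have := h (inr None) => /= -[_ []//]; by exists y.
- by have := h (inr (Some x)) => /= -[/(_ erefl) ->].
Qed.

Lemma measurable_joined p a :
  measurable [set v : p.-tuple M | joined union_move v a].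
Proof.
apply: (measurable_eq measurable_separating separatingP).
  apply: (measurableT_comp (f := act union_move a.1)); first exact: measurable_act.
  exact: measurable_tnth.
exact: measurable_tnth.
Qed.

Lemma measurable_map_seq d' (Y : measurableType d') (I : Type) (F : I -> Y -> bool)
    (l : seq I) (s : seq bool) :
  (forall i, measurable [set y | F i y]) ->
  measurable [set y | [seq F i y | i <- l] = s].
Proof.
move=> mF; elim: l s => [|i l IH] [|b s] /=.
- by rewrite (_ : [set _ | _] = setT) //; apply/seteqP; split.
- by rewrite (_ : [set _ | _] = set0) //; apply/seteqP; split.
- by rewrite (_ : [set _ | _] = set0) //; apply/seteqP; split.
rewrite (_ : [set _ | _] = (if b then [set y | F i y] else ~` [set y | F i y]) `&`
   [set y | [seq F i y | i <- l] = s]).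
  by apply: measurableI => //; case: b => //; exact: measurableC.
apply/seteqP; split => y /=.
  by case=> <- <-; split=> //; case: ifPn => // /negP.
by case; case: b => /= [Fb|/negP/negbTE Fb] <-; rewrite Fb.
Qed.

Lemma measurable_union_typ r a : measurable ([set x | typ T r x == a] : set X) ->
  measurable ([set u | typ union_move r u == a] : set M).
Proof.
move=> m; rewrite measurable_unionE (_ : _ @^-1` _ = [set x | typ T r x == a]) //.
by apply/seteqP; split => x /=; rewrite typ_inl.
Qed.

(** Unlike [tuple_typ], this also records coincidences between different entries, so it determines
    the tuple up to [eqv]. *)
Definition full_typ r p (v : p.-tuple M) : seq bool :=
  [seq joined union_move v a |
     a <- [seq (w, ij) | w <- words J r, ij <- enum {: 'I_p * 'I_p}]].

Lemma full_typP r p (v v' : p.-tuple M) : full_typ r v = full_typ r v' ->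
  eqv union_move union_move r v v'.
Proof.
move=> /map_eqP h i j w wr; apply: (h (w, (i, j))).
by apply/allpairsP; exists (w, (i, j)); rewrite /= mem_words mem_enum.
Qed.

(** By locality the solutions are a union of level sets of [full_typ], each cut out by finitely many
    measurable coincidences. *)
Lemma measurable_solutions (L : sgraph M) p (phi : formula p) :
  gen_by union_move L -> measurable (solutions L phi).
Proof.
move=> ML; have [r h] := sat_eqv union_moveK ML phi.
rewrite (_ : solutions L phi = \bigcup_(s : seq bool)
   (if `[< exists2 v, full_typ r v = s & sat L phi v >]
    then [set v | full_typ r v = s] else set0)).
  apply: countable_bigcupT_measurable => [|s]; first exact: countableP.
  case: ifP => _; last exact: measurable0.
  by apply: measurable_map_seq => a; exact: measurable_joined.
apply/seteqP; split => v.
  move=> vphi; exists (full_typ r v) => //; case: ifPn => // /asboolP[].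
  by exists v.
move=> [s _]; case: ifP => // /asboolP[v' v's v'phi] /= vs.
by apply/(h v v') => //; apply: full_typP; rewrite vs v's.
Qed.

Variable mu : probability X R.
Local Notation m := (union_measure mu W).

Lemma union_measureE (A : set M) : m A = mu (inl @^-1` A).
Proof. by []. Qed.

Variables (lam : nat -> X -> nat) (b : nat -> nat).
Hypothesis lam_lt : forall r x, (lam r x < b r)%N.
Hypothesis mlam : forall r a, measurable [set x | lam r x == a].
Hypothesis mu_lam : forall r a, (mu [set x | lam r x == a] <= (r.+1%:R^-1)%:E)%E.

Definition union_lam r (u : M) : option nat :=
  if u is inl x then Some (lam r x) else None.

Lemma measurable_union_lam r a : measurable ([set u | union_lam r u == Some a] : set M).
Proof.
rewrite measurable_unionE (_ : _ @^-1` _ = [set x | lam r x == a]) //.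
Qed.


Lemma clustered_null p r : let C := [set v : p.-tuple M | clustered union_move r v] in
  measurable C /\ power_measure m p C = 0%E.
Proof.
have null a : a.2.1 != a.2.2 ->
    power_measure m p [set v | joined union_move v a] = 0%E.
  move=> ij; apply: (power_measure_coords (lam := union_lam) (b := b) ij) => //.
  - exact: measurable_act.
  - exact: measurable_joined.
  - move=> q [c|]; first exact: measurable_union_lam.
    by rewrite measurable_unionE (_ : _ @^-1` _ = set0) //; apply/seteqP; split.
  - move=> q; rewrite union_measureE (_ : _ @^-1` _ = set0) ?measure0 //.
    by apply/seteqP; split.
  - by move=> q c [x|//] /= [<-].
have h : {in word_pairs J r p, forall a, a.2.1 != a.2.2}.
  by move=> [w [i j]]; rewrite mem_word_pairs => /andP[].
rewrite /clustered /=; elim: (word_pairs J r p) h => [_|a l IH h] /=.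
  by rewrite (_ : [set _ | _] = set0) ?measure0 //; apply/seteqP; split.
have [|m1 n1] := IH; first by move=> c cl; apply: h; rewrite inE cl orbT.
rewrite (_ : [set _ | _] = [set v | joined union_move v a] `|`
    [set v | has (joined union_move v) l]); last first.
  by apply/seteqP; split => v /= /orP.
have ma := @measurable_joined p a; split; first exact: measurableU.
by rewrite measureU0 //; apply: null; apply: h; rewrite mem_head.
Qed.

Section stone.
Variables (V : nat -> finType) (U : set_system nat).
Hypothesis UU : UltraFilter U.
Let FU : Filter U. Proof. exact: filter_filter. Qed.
Hypothesis Voo : forall N, \forall n \near U, (N <= #|V n|)%N.
Variable t : forall n, J -> V n -> V n.
Hypothesis tK : forall n j, involutive (@t n j).
Variables (G : forall n, sgraph (V n)).
Hypothesis tG : forall n, gen_by (@t n) (G n).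
Hypothesis typ_cvg : forall r a,
  measurable ([set x | typ T r x == a] : set X) /\
  (density R (fun v : V n => typ (@t n) r v == a))%:E @[n --> U] -->
    mu [set x | typ T r x == a].
Hypothesis manyX : forall x r k, \forall n \near U, many (@t n) r (typ T r x) k.
Hypothesis manyW : forall r a k,
  many S r a k <-> \forall n \near U, many (@t n) r a k.

(** If the list meets [X], its type is abundant in almost all graphs by [manyX]; otherwise the list
    lies in [W]. *)
Lemma many_union r a k :
  many union_move r a k <-> \forall n \near U, many (@t n) r a k.
Proof.
split=> [[s [us ss sa]]|/manyW[s [us ss sa]]]; last first.
  exists (map (inr : W -> M) s); split; rewrite ?size_map //.
    by rewrite map_inj_uniq // => x y [].
  by move=> _ /mapP[w ws ->]; rewrite typ_inr; exact: sa.
have [/hasP[[x|//] xs _]|/hasPn sW] :=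
  boolP (has (fun u : M => if u is inl _ then true else false) s).
  by rewrite -(sa _ xs) typ_inl.
apply/manyW; pose g (u : M) : option W := if u is inr w then Some w else None.
have e : s = map (inr : W -> M) (pmap g s).
  elim: s sW {us ss sa} => //= u s IH sW.
  have := sW u (mem_head _ _); case: u sW => [//|w] sW _ /=; congr cons.
  by apply: IH => u us; apply: sW; rewrite inE us orbT.
exists (pmap g s); split; first by move: us; rewrite {1}e map_inj_uniq // => x y [].
  by rewrite -ss {2}e size_map.
by move=> w ws; rewrite -(@typ_inr r w); apply: sa; rewrite e map_f.
Qed.

(** Prescribing the types of all entries is a box, so both sides factor into one-variable
    quantities. *)
Lemma tuple_typ_cvg p r (a : p.-tuple (type_of J r)) :
  measurable [set v : p.-tuple M | tuple_typ union_move r v == a] /\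
  (density R (fun v : p.-tuple (V n) => tuple_typ (@t n) r v == a))%:E @[n --> U] -->
    power_measure m p [set v | tuple_typ union_move r v == a].
Proof.
pose A i := [set u : M | typ union_move r u == val (tnth a i)].
have mA i : measurable (A i).
  by apply: measurable_union_typ; exact: (typ_cvg r (val (tnth a i))).1.
have -> : [set v : p.-tuple M | tuple_typ union_move r v == a] =
    [set v | forall i, A i (tnth v i)].
  by apply/seteqP; split => v /=; rewrite tuple_typP => /forallP.
split; first exact: measurable_box.
rewrite power_measure_box //.
have dE n : density R (fun v : p.-tuple (V n) => tuple_typ (@t n) r v == a) =
    \prod_(i < p) density R (fun x : V n => typ (@t n) r x == val (tnth a i)).
  rewrite -(density_box R (fun i (x : V n) => typ (@t n) r x == val (tnth a i))).
  by apply: density_eq => v; rewrite tuple_typP.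
under eq_fun do rewrite dE.
under eq_bigr do rewrite -(fineK (fin_num_measure m _ (mA _))).
rewrite prodEFin; apply/cvg_EFin; first exact: nearW.
apply: cvg_big => [|i _]; first exact: mul_continuous.
have [mx c] := typ_cvg r (val (tnth a i)).
rewrite -(fineK (fin_num_measure mu _ mx)) in c; move/fine_cvgP: c => [_ c].
have e : fine (m (A i)) = fine (mu [set x | typ T r x == val (tnth a i)]).
  rewrite union_measureE; congr (fine (mu _)).
  by apply/seteqP; split => x; rewrite /A /= typ_inl.
by rewrite e; exact: c.
Qed.

Lemma stone_density p (phi : formula p) n :
  stone_pairing R phi (G n) = density R (fun v => `[< sat (G n) phi v >]).
Proof.
rewrite /stone_pairing /density card_tuple natrX cardsE.
by congr (_%:R / _); apply: eq_card.
Qed.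

(** Union bound over finitely many coincidences, each of density at most [1 / #|V n|]. *)
Lemma density_clustered_cvg0 p r :
  density R (fun v : p.-tuple (V n) => clustered (@t n) r v) @[n --> U] --> 0.
Proof.
pose N := size (word_pairs J r p).
have le n : density R (fun v : p.-tuple (V n) => clustered (@t n) r v) <=
    N%:R / #|V n|%:R.
  apply: le_trans (density_has R (word_pairs J r p)
    (fun a (v : p.-tuple (V n)) => joined (@t n) v a)) _.
  rewrite /N -sum1_size natr_sum mulr_suml big_seq [leRHS]big_seq.
  apply: ler_sum => -[w [i j]]; rewrite mem_word_pairs => /andP[_ ij].
  by rewrite mul1r; exact: (density_coords R (act (@t n) w) ij).
apply/cvgr0Pnorm_lt => e e0.
apply: filterS (Voo (Num.trunc (N%:R / e)).+1) => n Vn.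
rewrite ger0_norm; last first.
  by case/andP: (density_itv R (fun v : p.-tuple (V n) => clustered (@t n) r v)).
apply: le_lt_trans (le n) _; rewrite ltr_pdivrMr; last first.
  by rewrite ltr0n; apply: leq_trans Vn.
rewrite mulrC -ltr_pdivrMr //; apply: (lt_le_trans (truncnS_gt _)).
by rewrite ler_nat.
Qed.

Lemma union_stone_cvg (L : sgraph M) p (phi : formula p) : gen_by union_move L ->
  (stone_pairing R phi (G n))%:E @[n --> U] --> power_measure m p (solutions L phi).
Proof.
move=> ML; have mL := measurable_solutions phi ML.
have [r [Q [QM Qn]]] := separated_limit UU tK tG union_moveK many_union ML phi.
have [mcl ncl] := clustered_null p r.
pose l := [seq a <- enum {: p.-tuple (type_of J r)} | Q a].
have [mE cE] := density_mem_cvg FU (@tuple_typ_cvg p r) l.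
have lE a : (a \in l) = Q a by rewrite mem_filter mem_enum andbT.
set E := [set _ | _] in mE cE.
have -> : power_measure m p (solutions L phi) = power_measure m p E.
  (* The solutions and the union [E] of type classes become equal once the null set of clustered
     tuples is added to both. *)
  rewrite -(measureU0 mL mcl ncl) -(measureU0 mE mcl ncl); congr (power_measure m p _).
  apply/seteqP; split => v /=.
    move=> [vphi|]; auto; case: (boolP (clustered union_move r v)); auto.
    by move=> sv; left; rewrite /E /= lE; apply/(QM _ sv).
  move=> [vE|]; auto; case: (boolP (clustered union_move r v)); auto.
  by move=> sv; left; apply/(QM _ sv); rewrite -lE.
rewrite -(fineK (fin_num_measure (power_measure m p) _ mE)) in cE *.
apply/cvg_EFin; first exact: nearW.
move/fine_cvgP: cE => [_ cE]; have c0 := density_clustered_cvg0 p r.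
pose c n := density R (fun v : p.-tuple (V n) => tuple_typ (@t n) r v \in l).
pose e n := density R (fun v : p.-tuple (V n) => clustered (@t n) r v).
(* In almost all graphs the pairing differs from the density of the type classes by at most that of
   the clustered tuples. *)
apply: (@squeeze_cvgr _ _ _ _ (fun n => c n - e n) (fun n => c n + e n)).
- apply: filterS Qn => n hn /=; rewrite stone_density.
  have le (P P' : pred (p.-tuple (V n))) :
      (forall v, ~~ clustered (@t n) r v -> P v -> P' v) ->
      density R P <= density R P' + e n.
    move=> PP; rewrite /e /density -mulrDl -natrD ler_wpM2r ?invr_ge0 // ler_nat.
    rewrite -cardUI; apply: leq_trans (leq_addr _ _).
    apply: subset_leq_card; apply/fintype.subsetP => v; rewrite !inE /in_mem /= => Pv.
    by case: (boolP (clustered _ _ _)) => [|sv]; rewrite ?orbT // (PP _ sv Pv).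
  rewrite lerBlDr; apply/andP; split; apply: le => v sv; rewrite lE.
    by move=> Qv; apply/asboolP/(hn _ sv).
  by move=> /asboolP/(hn _ sv).
- by rewrite -[X in _ --> X]subr0; apply: cvgB.
- by rewrite -[X in _ --> X]addr0; apply: cvgD.
Qed.

End stone.

End union.

(** * Definability of balls *)

Definition lift_var p q (f : 'I_p -> 'I_q) (i : 'I_p.+1) : 'I_q.+1 :=
  if unlift ord0 i is Some j then lift ord0 (f j) else ord0.

Fixpoint rename p (phi : formula p) : forall q, ('I_p -> 'I_q) -> formula q :=
  match phi in formula p return forall q, ('I_p -> 'I_q) -> formula q with
  | FEq _ i j => fun q f => FEq (f i) (f j)
  | FAdj _ i j => fun q f => FAdj (f i) (f j)
  | FNot _ g => fun q f => FNot (rename g f)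
  | FAnd _ g h => fun q f => FAnd (rename g f) (rename h f)
  | FEx _ g => fun q f => FEx (rename g (lift_var f))
  end.

Lemma sat_rename T (G : sgraph T) p (phi : formula p) q (f : 'I_p -> 'I_q)
    (v : q.-tuple T) :
  sat G (rename phi f) v <-> sat G phi [tuple tnth v (f i) | i < p].
Proof.
elim: phi q f v => {p} [p i j|p i j|p g IH|p g IHg h IHh|p g IH] q f v /=;
  rewrite ?tnth_mktuple //.
- by have := IH q f v; tauto.
- by have := IHg q f v; have := IHh q f v; tauto.
have e x : [tuple tnth [tuple of x :: v] (lift_var f i) | i < p.+1] =
    [tuple of x :: [tuple tnth v (f i) | i < p]].
  apply: eq_from_tnth => i; rewrite tnth_mktuple /lift_var.
  by case: unliftP => [j ->|->]; rewrite ?tnthS ?tnth0 ?tnth_mktuple.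
by split=> -[x]; exists x; move: (IH _ (lift_var f) [tuple of x :: v]); rewrite e; tauto.
Qed.

(** The formula is chosen before the structure, so one formula serves the finite graphs and the
    limit alike. *)
Definition definable p (P : forall T, sgraph T -> p.-tuple T -> Prop) : Prop :=
  exists phi : formula p, forall T (G : sgraph T) v, sat G phi v <-> P T G v.

Section definable.
Implicit Types p q k : nat.

Lemma definable_iff p (P Q : forall T, sgraph T -> p.-tuple T -> Prop) :
  (forall T G v, P T G v <-> Q T G v) -> definable P -> definable Q.
Proof.
move=> PQ [phi h]; exists phi => T G v; have := h T G v; have := PQ T G v; tauto.
Qed.

Lemma definable_eq p (i j : 'I_p) : definable (fun T _ v => tnth v i = tnth v j).
Proof. by exists (FEq i j). Qed.

Lemma definable_adj p (i j : 'I_p) : definable (fun T G v => G (tnth v i) (tnth v j)).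
Proof. by exists (FAdj i j). Qed.

Lemma definable_not p P : definable P -> @definable p (fun T G v => ~ P T G v).
Proof. by move=> [f h]; exists (FNot f) => T G v /=; have := h T G v; tauto. Qed.

Lemma definable_and p P Q : definable P -> definable Q ->
  @definable p (fun T G v => P T G v /\ Q T G v).
Proof.
move=> [f h] [g k]; exists (FAnd f g) => T G v /=.
by have := h T G v; have := k T G v; tauto.
Qed.

Lemma definable_or p P Q : definable P -> definable Q ->
  @definable p (fun T G v => P T G v \/ Q T G v).
Proof.
move=> /definable_not hP /definable_not hQ.
apply: definable_iff (definable_not (definable_and hP hQ)) => T G v /=.
by have := pselect (P T G v); have := pselect (Q T G v); tauto.
Qed.

Lemma definable_equiv p P Q : definable P -> definable Q ->
  @definable p (fun T G v => P T G v <-> Q T G v).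
Proof.
move=> hP hQ; apply: definable_iff (definable_or (definable_and hP hQ)
  (definable_and (definable_not hP) (definable_not hQ))) => T G v /=.
by have := pselect (P T G v); have := pselect (Q T G v); tauto.
Qed.

Lemma definable_exists p (P : forall T, sgraph T -> p.+1.-tuple T -> Prop) :
  definable P -> definable (fun T G v => exists x, P T G [tuple of x :: v]).
Proof.
move=> [f h]; exists (FEx f) => T G v /=.
by split=> -[x]; exists x; apply/h.
Qed.

Lemma definable_forall p (P : forall T, sgraph T -> p.+1.-tuple T -> Prop) :
  definable P -> definable (fun T G v => forall x, P T G [tuple of x :: v]).
Proof.
move=> /definable_not/definable_exists/definable_not; apply: definable_iff => T G v /=.
split=> [h x|h [x]]; last by apply; exact: h.
by apply: contrapT => nP; apply: h; exists x.
Qed.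

Lemma definable_rename p q (f : 'I_p -> 'I_q)
    (P : forall T, sgraph T -> p.-tuple T -> Prop) :
  definable P -> definable (fun T G v => P T G [tuple tnth v (f i) | i < p]).
Proof.
move=> [phi h]; exists (rename phi f) => T G v.
have e := sat_rename G phi f v; have := h T G [tuple tnth v (f i) | i < p]; tauto.
Qed.

(** A fresh quantified variable gives a tautology even for [p = 0], where no variable is free. *)
Lemma definable_true p : @definable p (fun _ _ _ => True).
Proof.
apply: definable_iff (definable_forall (definable_eq ord0 ord0)) => T G v.
by [].
Qed.

Lemma definable_cst p (Q : Prop) : @definable p (fun _ _ _ => Q).
Proof.
have [q|q] := pselect Q.
  by apply: definable_iff (definable_true p) => T G v; split.
by apply: definable_iff (definable_not (definable_true p)) => T G v; tauto.
Qed.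

Lemma definable_all (I : finType) p (P : I -> forall T, sgraph T -> p.-tuple T -> Prop) :
  (forall i, definable (P i)) -> definable (fun T G v => forall i, P i T G v).
Proof.
move=> h; have : definable (fun T G v => {in enum I, forall i, P i T G v}).
  elim: (enum I) => [|i s IH].
    by apply: definable_iff (definable_true p) => T G v; split.
  apply: definable_iff (definable_and (h i) IH) => T G v; split.
    by move=> [Pi Ps] j; rewrite inE => /predU1P[->|/Ps].
  by move=> Ps; split=> [|j js]; apply: Ps; rewrite inE ?eqxx // js orbT.
apply: definable_iff => T G v; split=> [hs i|hs i _]; last exact: hs.
by apply: hs; rewrite mem_enum.
Qed.

Lemma definable_has (I : finType) p (P : I -> forall T, sgraph T -> p.-tuple T -> Prop) :
  (forall i, definable (P i)) -> definable (fun T G v => exists i, P i T G v).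
Proof.
move=> h; apply: definable_iff (definable_not (definable_all (fun i => definable_not (h i)))).
move=> T G v; split=> [/existsNP[i /contrapT Pi]|[i Pi] n]; first by exists i.
exact: n Pi.
Qed.

Lemma definable_exists_tuple k p (P : forall T, sgraph T -> (k + p).-tuple T -> Prop) :
  definable P ->
  definable (fun T G (v : p.-tuple T) => exists u : k.-tuple T, P T G [tuple of u ++ v]).
Proof.
elim: k P => [|k IH] P hP.
  apply: definable_iff hP => T G v.
  have e : v = [tuple of [tuple] ++ v] by apply: val_inj.
  split=> [Pv|[u]]; first by exists [tuple]; rewrite -e.
  by rewrite (tuple0 u) -e.
apply: definable_iff (IH _ (definable_exists hP)) => T G v; split.
  move=> [u [x Pxu]]; exists [tuple of x :: u]; congr P: Pxu.
  exact: val_inj.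
move=> [u Pu]; exists [tuple of behead u], (thead u); congr P: Pu.
by apply: val_inj; rewrite /= {1}(tuple_eta u).
Qed.

End definable.

Lemma dist_le0 T (G : sgraph T) x y : dist_le G 0 x y <-> x = y.
Proof.
split=> [[[|z s] [_ <- //]]|<-]; by exists [::].
Qed.

Lemma dist_leS T (G : sgraph T) r x y :
  dist_le G r.+1 x y <-> exists z, (x = z \/ G x z) /\ dist_le G r z y.
Proof.
split=> [[[|z s] [/= ps ly sr]]|[z [[->|xz] [s [ps ly sr]]]]].
- by exists x; split; [left|exists [::]].
- by case/andP: ps => xz ps; exists z; split; [right|exists s].
- by exists s; split=> //; exact: leqW.
- by exists (z :: s); rewrite /= xz.
Qed.

Lemma definable_dist r :
  definable (fun T G (v : 2.-tuple T) => dist_le G r (tnth v ord0) (tnth v ord_max)).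
Proof.
elim: r => [|r IH].
  by apply: definable_iff (definable_eq _ _) => T G v; rewrite dist_le0.
(* Variable [0] is the intermediate point bound by the quantifier; [1] and [2] are the two ends. *)
pose i0 : 'I_3 := ord0; pose i1 : 'I_3 := lift ord0 ord0; pose i2 : 'I_3 := ord_max.
have h := definable_rename (fun i : 'I_2 => if i == ord0 then i0 else i2) IH.
apply: definable_iff (definable_exists (definable_and (definable_or (definable_eq i1 i0)
  (definable_adj i1 i0)) h)) => T G v.
rewrite dist_leS.
have e0 z : tnth [tuple of z :: v] i0 = z by [].
have e1 z : tnth [tuple of z :: v] i1 = tnth v ord0 by rewrite tnthS.
have e2 z : tnth [tuple of z :: v] i2 = tnth v ord_max.
  by rewrite (_ : i2 = lift ord0 ord_max) ?tnthS //; apply: val_inj.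
by split=> -[z h']; exists z; move: h'; rewrite e1 e0 !tnth_mktuple /= e0 e2.
Qed.

Lemma ball_classP T (G : sgraph T) r (F : finType) (H : sgraph F) (o : F) x :
  ball_class G r H o x <-> exists y : F -> T, [/\ injective y,
    forall a b, G (y a) (y b) = H a b, y o = x &
    forall z, dist_le G r x z <-> exists a, z = y a].
Proof.
split=> [[f [[g fK gK] fE fo]]|[y [yI yE yo yB]]].
  exists (fun a => set_val (g a)); split.
  - by move=> a b /val_inj/(can_inj gK).
  - by move=> a b; rewrite -{2}(gK a) -{2}(gK b) fE.
  - by rewrite -fo fK.
  move=> z; split=> [xz|[a ->]]; last by have /set_mem := valP (g a).
  by exists (f (exist _ z (mem_set xz))); rewrite fK.
have memy a : y a \in gball G r x by apply/mem_set/yB; exists a.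
pose g a : set_type (gball G r x) := exist _ (y a) (memy a).
have /choice[f fP] : forall u : set_type (gball G r x), exists a, set_val u = y a.
  by move=> u; apply/yB; have /set_mem := valP u.
exists f; split.
- exists g => [u|a]; first by apply: val_inj; rewrite /= -fP.
  by apply: yI; rewrite -fP.
- by move=> u v; rewrite -yE -!fP.
- by apply: yI; rewrite -fP yo.
Qed.

Lemma definable_ball r (F : finType) (H : sgraph F) (o : F) :
  definable (fun T G (v : 1.-tuple T) => ball_class G r H o (tnth v ord0)).
Proof.
pose k := #|F|; pose y (a : F) : 'I_(k + 1) := lshift 1 (enum_rank a).
pose x : 'I_(k + 1) := rshift k ord0.
have d1 : definable (fun T G (v : (k + 1).-tuple T) =>
    forall ab : F * F, ab.1 = ab.2 \/ tnth v (y ab.1) <> tnth v (y ab.2)).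
  apply: definable_all => -[a b] /=; apply: definable_or; first exact: definable_cst.
  by apply: definable_not; exact: definable_eq.
have d2 : definable (fun T G (v : (k + 1).-tuple T) =>
    forall ab : F * F, G (tnth v (y ab.1)) (tnth v (y ab.2)) <-> H ab.1 ab.2).
  apply: definable_all => -[a b] /=; apply: definable_equiv; first exact: definable_adj.
  exact: definable_cst.
have d3 : definable (fun T G (v : (k + 1).-tuple T) => tnth v (y o) = tnth v x).
  exact: definable_eq.
have d4 : definable (fun T G (v : (k + 1).-tuple T) => forall z,
    dist_le G r (tnth v x) z <-> exists a, z = tnth v (y a)).
  have h1 := definable_rename (fun i : 'I_2 => if i == ord0 then lift ord0 x else ord0)
    (definable_dist r).
  have h2 := definable_has (fun a => @definable_eq (k + 1).+1 ord0 (lift ord0 (y a))).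
  apply: definable_iff (definable_forall (definable_equiv h1 h2)) => T G v.
  have e z : (exists a,
      tnth [tuple of z :: v] ord0 = tnth [tuple of z :: v] (lift ord0 (y a))) <->
      exists a, z = tnth v (y a).
    by split=> -[a]; rewrite ?tnthS ?tnth0 => h; exists a; rewrite ?tnthS ?tnth0.
  by split=> h z; have := h z; have := e z; rewrite !tnth_mktuple /= tnth0 tnthS; tauto.
have d := definable_exists_tuple (definable_and (definable_and d1 d2) (definable_and d3 d4)).
apply: definable_iff d => T G v; rewrite ball_classP.
have ye (u : k.-tuple T) a : tnth [tuple of u ++ v] (y a) = tnth u (enum_rank a).
  by rewrite tnth_lshift.
have xe (u : k.-tuple T) : tnth [tuple of u ++ v] x = tnth v ord0.
  by rewrite tnth_rshift.
split=> [[u [[u1 u2] [u3 u4]]]|[f [fI fE fo fB]]].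
  exists (fun a => tnth u (enum_rank a)); split.
  - by move=> a b ab; have := u1 (a, b); rewrite /= !ye => -[].
  - by move=> a b; have := u2 (a, b); rewrite /= !ye => h; apply/idP/idP => /h.
  - by move: u3; rewrite ye xe.
  - by move=> z; have := u4 z; rewrite xe => -[e1 e2]; split=> [/e1[a ->]|[a za]];
      [exists a; rewrite ye|apply: e2; exists a; rewrite ye].
pose u := [tuple f (enum_val i) | i < k].
have ue a : tnth [tuple of u ++ v] (y a) = f a.
  by rewrite ye tnth_mktuple enum_rankK.
exists u; split; split.
- move=> [a b] /=; rewrite !ue; case: (eqVneq a b) => [|/eqP ab]; first by left.
  by right => /fI.
- by move=> [a b] /=; rewrite !ue fE.
- by rewrite ue xe.
- by move=> z; rewrite xe fB; split=> -[a ->]; exists a; rewrite ue.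
Qed.

Section union_balls.
Variables (S T : Type) (G : sgraph S) (L : sgraph T).

(** Paths do not leave a summand, so balls around points of the graphing are unchanged in the
    union. *)
Lemma dist_le_inl r x u : dist_le (disjoint_union G L) r (inl x) u <->
  exists2 y, u = inl y & dist_le G r x y.
Proof.
elim: r x u => [|r IH] x u.
  by rewrite dist_le0; split=> [<-|[y -> /dist_le0 ->//]]; exists x; rewrite ?dist_le0.
rewrite dist_leS; split=> [[z [xz zu]]|[y -> /dist_leS[z [xz zy]]]].
  case: z xz zu => [z|z] [] //.
  - by case=> -> /IH[y -> zy]; exists y => //; apply/dist_leS; exists z; split; [left|].
  - by move=> xz /IH[y -> zy]; exists y => //; apply/dist_leS; exists z; split; [right|].
exists (inl z); split; last by apply/IH; exists y.
by case: xz => [->|xz]; [left|right].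
Qed.

Lemma ball_class_inl r (F : finType) (H : sgraph F) (o : F) x :
  ball_class (disjoint_union G L) r H o (inl x) <-> ball_class G r H o x.
Proof.
rewrite !ball_classP; split=> [[y [yI yE yo yB]]|[y [yI yE yo yB]]].
  have /choice[y' y'P] : forall a, exists x', y a = inl x'.
    move=> a; have [|x' e _] := (dist_le_inl r x (y a)).1; last by exists x'.
    by apply/yB; exists a.
  exists y'; split.
  - by move=> a b ab; apply: yI; rewrite !y'P ab.
  - by move=> a b; rewrite -yE !y'P.
  - by have := y'P o; rewrite yo => -[].
  move=> z; split=> [xz|[a ->]].
    have /yB[a] : dist_le (disjoint_union G L) r (inl x) (inl z).
      by apply/dist_le_inl; exists z.
    by rewrite y'P => -[->]; exists a.
  have /dist_le_inl[w [<-]//] : dist_le (disjoint_union G L) r (inl x) (inl (y' a)).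
  by apply/yB; exists a.
exists (fun a => inl (y a)); split.
- by move=> a b [/yI].
- by move=> a b; rewrite -yE.
- by rewrite yo.
move=> z; rewrite dist_le_inl; split=> [[w -> /yB[a ->]]|[a ->]]; first by exists a.
by exists (y a) => //; apply/yB; exists a.
Qed.

End union_balls.

(** * The limit theorem *)

Lemma exists_gen_by (J : finType) (T : eqType) (t : J -> T -> T) :
  (forall j, involutive (t j)) -> exists G : sgraph T, gen_by t G.
Proof.
move=> tK; pose e x y := (x != y) && [exists j, t j x == y].
have esym : symmetric e.
  move=> x y; rewrite /e eq_sym; congr (_ && _).
  by apply/existsP/existsP => -[j /eqP <-]; exists j; rewrite tK.
have eirr : irreflexive e by move=> x; rewrite /e eqxx.
by exists (SGraph esym eirr).
Qed.

Lemma stone_pairing0 (R : realType) (V : finType) (G : sgraph V) (phi : formula 0) :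
  stone_pairing R phi G = (`[< models G phi >] : nat)%:R.
Proof.
rewrite /stone_pairing expr0 divr1; congr _%:R; case: asboolP => h.
  rewrite (_ : [set _ | _]%SET = [set: 0.-tuple V]%SET) ?cardsT ?card_tuple //.
  by apply/setP => v; rewrite !inE tuple0; apply/asboolP.
apply/eqP; rewrite cards_eq0; apply/eqP/setP => v; rewrite !inE tuple0.
exact/asboolP.
Qed.

(** The pairings of the formula defining the ball are the required densities, and [W] carries no
    mass. *)
Lemma FO_limit_BS_limit (R : realType) (V : nat -> finType)
    (G : forall n, sgraph (V n)) d (X : measurableType d) (K : graphing R X)
    (W : countType) (L : sgraph W) :
  FO_limit G (disjoint_union (graphing_graph K) L : sgraph (union_space X W))
    (union_measure (graphing_mu K) W) -> BS_limit G K.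
Proof.
move=> FO r F H o; have [phi phiE] := definable_ball r H o.
set M := disjoint_union (graphing_graph K) L; have [mphi cphi] := FO 1%N phi.
pose B := [set u : union_space X W | ball_class M r H o u].
have solE : solutions (M : sgraph (union_space X W)) phi =
    [set v | forall i, B (tnth v i)].
  apply/seteqP; split => v; rewrite /solutions /=.
    by move=> /phiE h i; rewrite ord1.
  by move=> h; apply/phiE; exact: h.
have BE : (inl : X -> union_space X W) @^-1` B = ball_class (graphing_graph K) r H o.
  apply/seteqP; split => x /=; first by move/ball_class_inl.
  by move=> h; apply/ball_class_inl.
have mB : measurable (ball_class (graphing_graph K) r H o).
  (* Measurability of the solutions is pulled back along the map to one-entry tuples. *)
  rewrite -BE; pose g (u : union_space X W) : 1.-tuple (union_space X W) := [tuple u].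
  have mg : measurable_fun setT g.
    apply/measurable_fun_tnthP => i; rewrite (_ : _ \o _ = id); first exact: measurable_id.
    by apply/funext => u /=; rewrite ord1.
  have := mg measurableT _ mphi; rewrite setTI solE.
  rewrite (_ : g @^-1` _ = B) //; apply/seteqP; split => u /=; first by move=> /(_ ord0).
  by move=> Bu i; rewrite ord1.
split=> //.
have <- : power_measure (union_measure (graphing_mu K) W) 1
    (solutions (M : sgraph (union_space X W)) phi) =
    graphing_mu K (ball_class (graphing_graph K) r H o).
  rewrite solE (@power_measure_box _ _ _ _ 1 (fun=> B)) => [|_].
    by rewrite big_ord1 -BE.
  by rewrite -BE in mB.
apply: cvg_trans cphi; apply: near_eq_cvg; apply: nearW => n; congr EFin.
rewrite /stone_pairing expr1; congr (_%:R / _).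
pose g (x : V n) : 1.-tuple (V n) := [tuple x].
have gI : injective g by move=> x y /(congr1 (fun v => tnth v ord0)).
rewrite -(card_imset _ gI); apply: eq_card => v; rewrite inE.
apply/asboolP/imsetP => [/phiE h|[x]].
  exists (tnth v ord0); first by rewrite inE; apply/asboolP.
  by apply: eq_from_tnth => i; rewrite ord1.
by rewrite inE => /asboolP h ->; apply/phiE.
Qed.

Theorem theorem5 (R : realType) (d : nat) (V : nat -> finType)
    (G : forall n, sgraph (V n))
    (Gdeg : forall n, max_degree_le (G n) d)
    (Gcvg : FO_convergent R G)
    (Goo : #|V n| @[n --> \oo] --> \oo) :
  exists (disp : measure_display) (X : measurableType disp)
    (K : graphing R X) (W : countType) (L : sgraph W),
    [/\ BS_limit G K,
        elementary_limit G L &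
        FO_limit G
          (disjoint_union (graphing_graph K) L : sgraph (union_space X W))
          (union_measure (graphing_mu K) W)].
Proof.
have [U [UU Uoo]] := ultraFilterLemma (eventually_filter).
have FU : Filter U by exact: filter_filter.
have Voo N : \forall n \near U, (N <= #|V n|)%N.
  by apply: Uoo; exact: (Goo _ (nbhs_infty_ge N)).
pose t n := sval (cid (exists_involutions (@Gdeg n))).
have tK n j : involutive (t n j).
  by have [h _] := svalP (cid (exists_involutions (@Gdeg n))); exact: h.
have tG n : gen_by (t n) (G n).
  by have [_ h] := svalP (cid (exists_involutions (@Gdeg n))); exact: h.
have [dX [X [mu [T [[borelX TK mT Tmu] [typ_cvg manyX [C mC Csep]
  [lam [b [lam_lt mlam mu_lam]]]]]]]]] := exists_limit_space R UU Voo tK.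
pose K := Graphing borelX mT TK Tmu.
have KT : gen_by T (graphing_graph K) by [].
have [W [S [SK manyW]]] := exists_countable_limit UU tK.
have [L SL] := exists_gen_by SK.
have ML := gen_by_union KT SL.
set M := disjoint_union _ _ in ML.
have sol p (phi : formula p) : measurable (solutions (M : sgraph (union_space X W)) phi).
  exact: (measurable_solutions TK mT SK mC Csep).
have cvgU p (phi : formula p) : (stone_pairing R phi (G n))%:E @[n --> U] -->
    power_measure (union_measure mu W) p (solutions (M : sgraph (union_space X W)) phi).
  exact: (union_stone_cvg TK mT SK mC Csep lam_lt mlam mu_lam UU Voo tK tG
    typ_cvg manyX manyW).
have FO : FO_limit G (M : sgraph (union_space X W)) (union_measure mu W).
  move=> p phi; split=> //.
  have /cvg_ex[l cl] := Gcvg _ phi.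
  have clE : (stone_pairing R phi (G n))%:E @[n --> \oo] --> l%:E.
    by apply/cvg_EFin => //; exact: nearW.
  (* The ordinary limit exists by [Gcvg]; it is also the limit along the finer [U], hence equals the
     measure. *)
  rewrite (_ : power_measure _ _ _ = l%:E) //.
  apply: (cvg_unique _ (cvgU p phi)); first exact: ereal_hausdorff.
  by move=> A lA; apply: Uoo; exact: clE.
exists dX, X, K, W, L; split=> //; first exact: FO_limit_BS_limit FO.
move=> phi; apply: iff_trans (sentence_limit UU tK tG SK manyW SL phi) _.
split=> [mU|]; last exact: Uoo.
have /cvg_ex[l cl] := Gcvg _ phi.
(* Pairings of a sentence are [0] or [1]; truth along [U] forces the limit [1], so the pairing is
   positive from some index on. *)
have l1 : l = 1.
  have clU : stone_pairing R phi (G n) @[n --> U] --> l.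
    by move=> A lA; apply: Uoo; exact: cl.
  apply: (cvg_unique _ clU); first exact: Rhausdorff.
  apply: cvg_near_cst; apply: filterS mU => n mn.
  by rewrite stone_pairing0 (asboolT mn).
rewrite l1 in cl.
have : \forall n \near \oo, 0 < stone_pairing R phi (G n) by exact: cvgr_gt cl _ ltr01.
apply: filterS => n; rewrite stone_pairing0.
by case: asboolP => //; rewrite ltxx.
Qed.
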